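(* Let $H$ be a separable complex Hilbert space, let $1<p<\infty$, and let $A\in\mathcal{B}_p(H)$ with polar decompositions $A=U|A|$ and $A^*=V|A^*|$. Then the following conditions are equivalent: (1) $w_p(A)=\|A\|_p$. (2) $A\parallel^p A^*$. (3) $\big|\mathrm{tr}(|A|^{p-1}U^*A^* )\big|=\|A\|_p^p$. (4) $\big|\mathrm{tr}(|A^*|^{p-1}V^*A)\big|=\|A^*\|_p^p$. (5) $A=\alpha A^*$ for some $\alpha\in\mathbb{T}$.
   Context: $\mathbb{T}=\{\alpha\in\mathbb{C}:|\alpha|=1\}$. $|T|=(T^*T)^{1/2}$ for $T\in\mathcal{B}(H)$. $\mathcal{B}_p(H)$ is the $p$-Schatten class: the compact operators $A$ on $H$ with $\|A\|_p=(\mathrm{tr}|A|^p)^{1/p}<\infty$. For $T\in\mathcal{B}(H)$, $Re(T)=\frac{T+T^*}{2}$, and $w_p(A)=\sup_{\theta\in\mathbb{R}}\|Re(e^{i\theta}A)\|_p$. For $A,B\in\mathcal{B}_p(H)$, $A\parallel^p B$ (norm-parallelism) means that there exists $\lambda\in\mathbb{T}$ with $\|A+\lambda B\|_p=\|A\|_p+\|B\|_p$. *)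

(* Defs.v *)
From HB Require Import structures.
From mathcomp Require Import all_boot all_order all_algebra.
From mathcomp Require Import complex.
From mathcomp Require Import all_classical all_reals all_analysis.

Set Implicit Arguments.
Unset Strict Implicit.
Unset Printing Implicit Defensive.

Import Order.TTheory GRing.Theory Num.Theory.
Import numFieldNormedType.Exports.

Local Open Scope classical_set_scope.
Local Open Scope complex_scope.
Local Open Scope ring_scope.

(* A complex Hilbert space is a Banach space over R[i] whose norm comes from
   an inner product. As in [{dot _ for _}], the inner product is linear in its
   first argument and conjugate-linear in the second one. *)
HB.mixin Record isHilbert (R : realType) H of CompleteNormedModule R[i] H := {
  dotp : {dot H for (@conjc R)} ;
  dotp_norm : forall x : H, `|x| ^+ 2 = dotp x x }.

#[short(type="hilbertType")]
HB.structure Definition Hilbert (R : realType) :=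
  {H of CompleteNormedModule R[i] H & isHilbert R H}.

Notation "''[' x , y ]" := (dotp x%R y%R)
  (format "''[' x ,  y ]") : ring_scope.

Definition separable (T : topologicalType) : Prop :=
  exists D : set T, countable D /\ dense D.

(* Operators on H are plain functions H -> H, so that sums and scalar multiples
   are those of the function space and products are compositions. The operators
   given by [xget] below are the unique ones with the stated property (and 0 when
   there is none). *)
Section Operators.
Context {R : realType} {H : hilbertType R}.
Implicit Types (T S P Q U : H -> H) (p s : R).

Definition bounded_op T : Prop := linear T /\ continuous T.

Definition compact_op T : Prop :=
  bounded_op T /\ precompact (T @` [set x : H | `|x| <= 1]).

Definition adjoint T : H -> H :=
  xget (0 : H -> H) [set S | forall x y, '[T x, y] = '[x, S y]].

(* In R[i], [0 <= z] means that z is real and nonnegative. *)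
Definition positive_op T : Prop :=
  bounded_op T /\ forall x, 0 <= '[T x, x].

(* |T| = (T^* T)^(1/2), the positive square root of T^* T *)
Definition abs_op T : H -> H :=
  xget (0 : H -> H) [set S | positive_op S /\ S \o S = adjoint T \o T].

(* P^s for P positive and compact, and s > 0. The functional calculus is
   P^s = sum_n (t_n)^s <., e_n> e_n when P = sum_n t_n <., e_n> e_n is the
   spectral decomposition of P: P^s is the bounded operator acting as t^s on
   each eigenspace ker (P - t). The eigenvectors of P span a dense subspace, so
   there is only one such operator. *)
Definition pow_op P s : H -> H :=
  xget (0 : H -> H)
    [set Q | bounded_op Q /\
      forall (t : R) (v : H), P v = t%:C *: v -> Q v = (t `^ s)%:C *: v].

(* The nonzero terms of e are a maximal orthonormal family. Terms equal to 0
   are allowed so that spaces of every finite dimension have such a sequence. *)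
Definition orthonormal_basis (e : nat -> H) : Prop :=
  [/\ forall m n, m != n -> '[e m, e n] = 0,
      forall n, e n = 0 \/ `|e n| = 1
    & forall x, (forall n, '[x, e n] = 0) -> x = 0].

(* T is trace class with trace c. *)
Definition is_trace T (c : R[i]) : Prop :=
  forall e, orthonormal_basis e ->
    series (fun n => '[T (e n), e n] : R[i]^o) @ \oo --> (c : R[i]^o).

Definition trace T : R[i] := xget 0 (is_trace T).

(* The compact operators T with tr |T|^p < oo; as |T|^p is positive, its trace
   is finite exactly when it is trace class. *)
Definition schatten_class p T : Prop :=
  compact_op T /\ exists c, is_trace (pow_op (abs_op T) p) c.

Definition schatten_norm p T : R :=
  complex.Re (trace (pow_op (abs_op T) p)) `^ p^-1.

Definition re_op T : H -> H := 2^-1 *: (T + adjoint T).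

Definition cis (t : R) : R[i] := cos t +i* sin t.

Definition schatten_numerical_radius p T : R :=
  sup [set schatten_norm p (re_op (cis t *: T)) | t in [set: R]].

Definition norm_parallel p T S : Prop :=
  exists lambda : R[i], `|lambda| = 1 /\
    schatten_norm p (T + lambda *: S) = schatten_norm p T + schatten_norm p S.

(* U is isometric on the orthogonal complement of its kernel. *)
Definition partial_isometry U : Prop :=
  bounded_op U /\
  forall x, (forall z, U z = 0 -> '[x, z] = 0) -> `|U x| = `|x|.

Definition polar_decomposition T U : Prop :=
  [/\ partial_isometry U, T = U \o abs_op T & forall x, U x = 0 <-> T x = 0].

End Operators.

(* Main.v *)
(* Everything rests on a quantitative form of Hoelder's inequality. Let
   A = sum_k s_k <., e_k> f_k and C = sum_n t_n <., g_n> h_n be singular value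
   decompositions. Then
     sum_n t_n^(p-1) <A g_n, h_n> = sum_(n, k) t_n^(p-1) s_k <g_n, e_k> <f_k, h_n>,
   and Young's inequality for t_n^(p-1) s_k, the arithmetic-geometric mean
   inequality for the products of coefficients, and Bessel's inequality bound its
   real part by (1 - 1/p) sum t_n^p + (1/p) sum s_k^p. If sum s_k^p <= sum t_n^p
   and the bound is attained, then every term is extremal, which forces A = C.
   This gives (2) => (5), with C = A + lambda A^* compared to 2 A and to
   2 lambda A^*, and (3) => (5), with C = A compared to a unimodular multiple of
   A^*. The same inequality shows that ||A||_p^p is the supremum of
   sum_n |<A g_n, h_n>|^p over orthonormal systems, hence the triangle inequality
   and ||A^*||_p = ||A||_p. For (1) => (2), theta |-> ||Re (e^(i theta) A)||_p is
   continuous, so that the supremum is attained. *)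
Require Import Defs.
From HB Require Import structures.
From mathcomp Require Import all_boot all_order all_algebra.
From mathcomp Require Import complex ring lra.
From mathcomp Require Import all_classical all_reals all_analysis.

Import Order.TTheory GRing.Theory Num.Theory.
Import numFieldNormedType.Exports.

Set Implicit Arguments.
Unset Strict Implicit.
Unset Printing Implicit Defensive.

Local Open Scope classical_set_scope.
Local Open Scope complex_scope.
Local Open Scope ring_scope.

(** * Norms and inner products *)

(** The norm and the trace are chosen values with default 0, so a small norm does not show that an
    operator lies in the class, and nothing tells beforehand that A + lambda A^* does. Hence the
    detour through [sbnd], which bounds matrix coefficients over arbitrary orthonormal systems: it
    passes to sums at once, and only afterwards is a singular value decomposition of the sum chosen
    to turn the bound into a trace. Equality uses two kinds of strictness. Young's inequality with p
    > 1 is strict for t_n <> s_k, so g_n meets only those e_k with the same singular value; the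
    arithmetic-geometric mean inequality then matches <g_n, e_k> with the conjugate of <f_k, h_n>,
    which carries the identity from singular values to vectors. Only one trace formula has to be
    studied: (4) is (3) for A^*, and (5) passes to A^* with the conjugate of alpha. *)

Section Norm.
Context {R : realType}.

(* Norms over R[i] take their values in R[i]; [nrm] is the real number behind. *)
Definition nrm (V : normedZmodType R[i]) (x : V) : R := complex.Re `|x|.

Lemma nrmE (V : normedZmodType R[i]) (x : V) : `|x| = (nrm x)%:C.
Proof. by rewrite /nrm RRe_real// ger0_real. Qed.

Lemma nrm_ge0 (V : normedZmodType R[i]) (x : V) : 0 <= nrm x.
Proof. by rewrite -ler0c -nrmE normr_ge0. Qed.

Lemma nrmN (V : normedZmodType R[i]) (x : V) : nrm (- x) = nrm x.
Proof. by rewrite /nrm normrN. Qed.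

Lemma nrmC (V : normedZmodType R[i]) (x y : V) : nrm (x - y) = nrm (y - x).
Proof. by rewrite -nrmN opprB. Qed.

Lemma ler_nrmD (V : normedZmodType R[i]) (x y : V) :
  nrm (x + y) <= nrm x + nrm y.
Proof. by rewrite -lecR rmorphD/= -!nrmE ler_normD. Qed.

Lemma nrm0 (V : normedZmodType R[i]) : nrm (0 : V) = 0.
Proof. by rewrite /nrm normr0. Qed.

Lemma nrm_eq0 (V : normedZmodType R[i]) (x : V) : nrm x = 0 -> x = 0.
Proof. by move=> x0; apply/eqP; rewrite -normr_eq0 nrmE x0. Qed.

Lemma nrmM (a b : R[i]) : nrm (a * b) = nrm a * nrm b.
Proof. by apply: complexI; rewrite rmorphM/= -!nrmE normrM. Qed.

Lemma nrmZ (V : normedModType R[i]) a (x : V) : nrm (a *: x) = nrm a * nrm x.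
Proof. by apply: complexI; rewrite rmorphM/= -!nrmE normrZ. Qed.

Lemma nrm_conjc (a : R[i]) : nrm (conjc a) = nrm a.
Proof. by rewrite /nrm normcJ. Qed.

Lemma nrm_real (a : R) : nrm (a%:C : R[i]) = `|a|.
Proof. by rewrite /nrm normc_def/= expr0n addr0 sqrtr_sqr. Qed.

Lemma nrm_sqr (a : R[i]) : ((nrm a) ^+ 2)%:C = a * conjc a.
Proof. by rewrite rmorphXn/= -nrmE sqr_normc. Qed.

Lemma nrm_sqrE (a : R[i]) :
  nrm a ^+ 2 = complex.Re a ^+ 2 + complex.Im a ^+ 2.
Proof. by apply: complexI; rewrite add_Re2_Im2 rmorphXn/= -nrmE. Qed.

Lemma Re_le_nrm (a : R[i]) : complex.Re a <= nrm a.
Proof.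
rewrite (le_trans (ler_norm _))// -lecR -nrmE; exact: normc_ge_Re.
Qed.

Lemma normRe_le_nrm (a : R[i]) : `|complex.Re a| <= nrm a.
Proof. rewrite -lecR -nrmE; exact: normc_ge_Re. Qed.

Lemma conjcM (a b : R[i]) : conjc (a * b) = conjc a * conjc b.
Proof. exact: rmorphM. Qed.
Lemma conjcD (a b : R[i]) : conjc (a + b) = conjc a + conjc b.
Proof. exact: rmorphD. Qed.
Lemma realcM (a b : R) : (a * b)%:C = a%:C * b%:C.
Proof. exact: rmorphM. Qed.
Lemma realcD (a b : R) : (a + b)%:C = a%:C + b%:C.
Proof. exact: rmorphD. Qed.
Lemma realc_sum I (r : seq I) (F : I -> R) :
  (\sum_(i <- r) F i)%:C = \sum_(i <- r) (F i)%:C.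
Proof. exact: rmorph_sum. Qed.

Lemma ReD (a b : R[i]) : complex.Re (a + b) = complex.Re a + complex.Re b.
Proof. by case: a b => [? ?] []. Qed.
Lemma ReN (a : R[i]) : complex.Re (- a) = - complex.Re a.
Proof. by case: a. Qed.
Lemma ReB (a b : R[i]) : complex.Re (a - b) = complex.Re a - complex.Re b.
Proof. by rewrite ReD ReN. Qed.
Lemma ReJ (a : R[i]) : complex.Re (conjc a) = complex.Re a.
Proof. by case: a. Qed.
Lemma ReZ (a : R) (b : R[i]) : complex.Re (a%:C * b) = a * complex.Re b.
Proof. by case: b => u v /=; rewrite mul0r subr0. Qed.
Lemma Re_sum I (r : seq I) (F : I -> R[i]) :
  complex.Re (\sum_(i <- r) F i) = \sum_(i <- r) complex.Re (F i).
Proof. exact: (big_morph (@complex.Re R) ReD). Qed.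

Lemma cvg_nrmP (V : normedModType R[i]) T (F : set_system T) (u : T -> V) l :
  Filter F ->
  u @ F --> l <-> (nrm (u t - l) @[t --> F] --> (0 : R)).
Proof.
split.
  move/cvgrPdist_lt => ul; apply/cvgrPdist_lt => e e0.
  have /ul : 0 < e%:C by rewrite ltcR.
  apply: filterS => t; rewrite sub0r normrN ger0_norm ?nrm_ge0//.
  by rewrite nrmE ltcR nrmC.
move/cvgrPdist_lt => ul; apply/cvgrPdist_lt => e e0.
(* A positive element of R[i] is real, so real radii suffice. *)
have eE : e = (complex.Re e)%:C by rewrite RRe_real// ger0_real// ltW.
have /ul : 0 < complex.Re e by rewrite -ltcR -eE.
apply: filterS => t; rewrite sub0r normrN ger0_norm ?nrm_ge0//.
by rewrite nrmC nrmE eE ltcR.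
Qed.

Lemma cvg_nrm0_le (V : normedModType R[i]) T (F : set_system T) (u : T -> V) l
    (v : T -> R) {FF : Filter F} :
  (forall t, nrm (u t - l) <= v t) -> v t @[t --> F] --> (0 : R) -> u @ F --> l.
Proof.
move=> uv v0; apply/cvg_nrmP.
apply: squeeze_cvgr v0; last exact: cvg_cst.
by near=> t; rewrite nrm_ge0 uv.
Unshelve. all: by end_near. Qed.

Lemma cvg_Re T (F : set_system T) (u : T -> R[i]) (l : R[i]) {FF : Filter F} :
  (u : T -> R[i]^o) @ F --> (l : R[i]^o) ->
  complex.Re (u t) @[t --> F] --> complex.Re l.
Proof.
move=> /cvg_nrmP/cvgrPdist_lt ul; apply/cvgrPdist_lt => e /ul.
apply: filterS => t; rewrite sub0r normrN ger0_norm ?nrm_ge0// nrmC => h.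
by rewrite (le_lt_trans _ h)// -ReB normRe_le_nrm.
Qed.

Lemma cvg_realc T (F : set_system T) (u : T -> R) (l : R) {FF : Filter F} :
  u @ F --> l -> ((u t)%:C : R[i]^o) @[t --> F] --> (l%:C : R[i]^o).
Proof.
move=> /cvgrPdist_lt ul; apply/cvg_nrmP/cvgrPdist_lt => e /ul.
apply: filterS => t h; rewrite sub0r normrN ger0_norm ?nrm_ge0// nrmC.
apply: le_lt_trans h; rewrite -nrm_real.
by rewrite (rmorphB (real_complex R)).
Qed.

Lemma cvg_nrm (V : normedModType R[i]) T (F : set_system T) (u : T -> V) l
    {FF : Filter F} : u @ F --> l -> nrm (u t) @[t --> F] --> nrm l.
Proof.
move=> /cvg_norm/cvg_Re h.
exact: (cvg_trans _ h).
Qed.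

Lemma cauchy_nrmP (V : completeNormedModType R[i]) (u : nat -> V) :
  (forall e : R, 0 < e -> exists N, forall m n, (N <= m)%N -> (m <= n)%N ->
    nrm (u n - u m) < e) -> cvg (u @ \oo).
Proof.
move=> h; apply/cauchy_cvgP/cauchyP => _/posnumP[e].
have [N hN] : exists N, forall m n, (N <= m)%N -> (m <= n)%N ->
    nrm (u n - u m) < complex.Re e%:num.
  by apply: h; have := [gt0 of e%:num]; rewrite ltcE => /andP[].
exists (u N), N => // n /= Nn.
rewrite -ball_normE /= distrC nrmE.
have -> : e%:num = (complex.Re e%:num)%:C by rewrite RRe_real// ger0_real.
by rewrite ltcR hN.
Qed.

End Norm.

Section Dot.
Context {R : realType} {H : hilbertType R}.
Implicit Types x y z : H.

Lemma dotDl x y z : '[x + y, z] = '[x, z] + '[y, z].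
Proof. exact: linearDl. Qed.
Lemma dotDr x y z : '[z, x + y] = '[z, x] + '[z, y].
Proof. exact: linearDr. Qed.
Lemma dotZl a x z : '[a *: x, z] = a * '[x, z].
Proof. exact: linearZl_LR. Qed.
Lemma dotZr a x z : '[z, a *: x] = conjc a * '[z, x].
Proof. exact: linearZr_LR. Qed.
Lemma dot0l z : '[0, z] = 0 :> R[i]. Proof. exact: linear0l. Qed.
Lemma dot0r z : '[z, 0] = 0 :> R[i]. Proof. exact: linear0r. Qed.
Lemma dotNr x z : '[z, - x] = - '[z, x]. Proof. exact: linearNr. Qed.
Lemma dotBl x y z : '[x - y, z] = '[x, z] - '[y, z].
Proof. exact: linearBl. Qed.
Lemma dotBr x y z : '[z, x - y] = '[z, x] - '[z, y].
Proof. exact: linearBr. Qed.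
Lemma dot_suml I r (P : pred I) (E : I -> H) z :
  '[\sum_(i <- r | P i) E i, z] = \sum_(i <- r | P i) '[E i, z].
Proof. exact: linear_sumlz. Qed.
Lemma dot_sumr I r (P : pred I) (E : I -> H) z :
  '[z, \sum_(i <- r | P i) E i] = \sum_(i <- r | P i) '[z, E i].
Proof. exact: linear_sumr. Qed.
Lemma dotC x y : '[x, y] = conjc '[y, x].
Proof. by rewrite hermC expr0 mul1r. Qed.

Lemma dotxx x : '[x, x] = (nrm x ^+ 2)%:C.
Proof. by rewrite -dotp_norm nrmE rmorphXn. Qed.

Lemma nrm_dotE x : nrm x ^+ 2 = complex.Re '[x, x].
Proof. by rewrite dotxx. Qed.

Lemma dot_eq0 x : '[x, x] = 0 -> x = 0.
Proof.
rewrite dotxx => -[/eqP]; rewrite sqrf_eq0 => /eqP; exact: nrm_eq0.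
Qed.

Lemma nrm_sqrD x y :
  nrm (x + y) ^+ 2 = nrm x ^+ 2 + complex.Re '[x, y] *+ 2 + nrm y ^+ 2.
Proof.
rewrite !nrm_dotE dotDl !dotDr !ReD [in X in _ + (complex.Re X + _)]dotC ReJ mulr2n.
ring.
Qed.

Lemma nrm_sqrB x y :
  nrm (x - y) ^+ 2 = nrm x ^+ 2 - complex.Re '[x, y] *+ 2 + nrm y ^+ 2.
Proof. by rewrite nrm_sqrD dotNr ReN nrmN mulNrn. Qed.

(** Cauchy-Schwarz: [x] minus its projection on [y] has nonnegative square norm. *)
Lemma nrm_dot x y : nrm '[x, y] <= nrm x * nrm y.
Proof.
have [y0|y0] := eqVneq (nrm y) 0.
  by rewrite (nrm_eq0 y0) dot0r !nrm0 mulr0.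
have yp : 0 < nrm y by rewrite lt_neqAle eq_sym y0 nrm_ge0.
have := sqr_ge0 (nrm (x - ('[x, y] * ((nrm y ^+ 2)^-1)%:C) *: y)).
rewrite nrm_sqrB dotZr nrmZ nrmM nrm_real ger0_norm ?invr_ge0 ?sqr_ge0//.
rewrite conjcM conjc_real mulrAC mulrC [X in _ * X]mulrC -nrm_sqr ReZ.
move=> h; rewrite -(@ler_pXn2r _ 2) ?nnegrE ?mulr_ge0 ?nrm_ge0//.
rewrite exprMn -ler_pdivrMr ?exprn_gt0//.
suff : nrm '[x,y] / nrm y ^+ 2 * nrm y = nrm '[x, y] / nrm y.
  move=> e; rewrite e expr_div_n mulr2n in h.
  by rewrite /= in h; lra.
by field.
Qed.

Lemma cvg_dotl T (F : set_system T) (u : T -> H) l y {FF : Filter F} :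
  u @ F --> l -> ('[u t, y] : R[i]^o) @[t --> F] --> ('[l, y] : R[i]^o).
Proof.
move=> /cvg_nrmP ul.
apply: (@cvg_nrm0_le _ _ _ F _ _ (fun t => nrm (u t - l) * nrm y)).
  by move=> t; rewrite -dotBl nrm_dot.
by rewrite -(mul0r (nrm y)); apply: cvgMr_tmp.
Qed.

Lemma cvg_dotr T (F : set_system T) (u : T -> H) l y {FF : Filter F} :
  u @ F --> l -> ('[y, u t] : R[i]^o) @[t --> F] --> ('[y, l] : R[i]^o).
Proof.
move=> /cvg_nrmP ul.
apply: (@cvg_nrm0_le _ _ _ F _ _ (fun t => nrm y * nrm (u t - l))).
  by move=> t; rewrite -dotBr nrm_dot.
by rewrite -(mulr0 (nrm y)); apply: cvgMl_tmp.
Qed.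

Lemma dot_ext x y : (forall z, '[x, z] = '[y, z]) -> x = y.
Proof.
by move=> h; apply/eqP; rewrite -subr_eq0; apply/eqP/dot_eq0; rewrite dotBl h subrr.
Qed.

Lemma dot_extr x y : (forall z, '[z, x] = '[z, y]) -> x = y.
Proof. by move=> h; apply: dot_ext => z; rewrite dotC h -dotC. Qed.

End Dot.

Lemma cvg_ext X (V : topologicalType) (F : set_system X) (u v : X -> V) (l : V) :
  u @ F --> l -> (forall t, u t = v t) -> v @ F --> l.
Proof. by move=> ul /funext <-. Qed.

(** * Linear and bounded operators *)

Section Operator.
Context {R : realType} {H : hilbertType R}.
Implicit Types (x y : H) (T S : H -> H).

Lemma linopD T : linear T -> forall x y, T (x + y) = T x + T y.
Proof. by move=> lT x y; rewrite -[x]scale1r lT !scale1r. Qed.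
Lemma linop0 T : linear T -> T 0 = 0.
Proof.
move=> /linopD/(_ 0 0); rewrite addr0 => /esym/eqP.
by rewrite -subr_eq0 addrK => /eqP.
Qed.
Lemma linopZ T : linear T -> forall a x, T (a *: x) = a *: T x.
Proof. by move=> lT a x; rewrite -[a *: x]addr0 lT (linop0 lT) addr0. Qed.
Lemma linopN T : linear T -> forall x, T (- x) = - T x.
Proof. by move=> lT x; rewrite -scaleN1r (linopZ lT) scaleN1r. Qed.
Lemma linopB T : linear T -> forall x y, T (x - y) = T x - T y.
Proof. by move=> lT x y; rewrite (linopD lT) (linopN lT). Qed.
Lemma linop_sum T : linear T -> forall I (r : seq I) (F : I -> H),
  T (\sum_(i <- r) F i) = \sum_(i <- r) T (F i).
Proof. by move=> lT I r F; exact: (big_morph T (linopD lT) (linop0 lT)). Qed.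

Lemma bounded_opP T : bounded_op T <->
  linear T /\ exists2 K : R, 0 <= K & forall x, nrm (T x) <= K * nrm x.
Proof.
split=> -[lT hT]; split=> //.
  pose mT := GRing.isLinear.Build R[i] H H _ T lT.
  pose fT : {linear H -> H} := HB.pack T mT.
  have /linear_boundedP h : bounded_near fT (nbhs (0 : H)).
    exact/linear_bounded_continuous.
  have [k [kr hk]] := h.
  have /hk{}hk : k < `|k| + 1.
    by rewrite (le_lt_trans (real_ler_norm kr))// ltrDl.
  exists (nrm k + 1); first by rewrite addr_ge0// nrm_ge0.
  move=> x; have := hk x; rewrite !nrmE -[1]/(1%:C) -realcD -realcM lecR.
  exact.
have [K K0 TK] := hT => x; apply: (@cvg_nrm0_le _ _ _ _ _ _
   (fun t => K * nrm (t - x))) => [t|]; first by rewrite -linopB.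
rewrite -(mulr0 K); apply: cvgMl_tmp.
by apply/cvg_nrmP; exact: cvg_id.
Qed.

Lemma bounded_op_cvg T X (F : set_system X) (u : X -> H) l {FF : Filter F} :
  bounded_op T -> u @ F --> l -> T (u t) @[t --> F] --> T l.
Proof. by move=> [_ cT] ul; apply: continuous_cvg ul; exact: cT. Qed.

Lemma bounded_op_comp T S : bounded_op T -> bounded_op S -> bounded_op (T \o S).
Proof.
move=> [lT cT] [lS cS]; split; first by move=> a x y /=; rewrite lS lT.
by move=> x; apply: continuous_comp; [exact: cS|exact: cT].
Qed.

Lemma bounded_opD T S : bounded_op T -> bounded_op S -> bounded_op (T + S).
Proof.
move=> /bounded_opP[lT [K K0 TK]] /bounded_opP[lS [L L0 SL]].
apply/bounded_opP; split.
  by move=> a x y; rewrite !fctE lS lT scalerDr !addrA [X in X + _]addrAC.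
exists (K + L); first exact: addr_ge0.
by move=> x; rewrite !fctE mulrDl (le_trans (ler_nrmD _ _))// lerD.
Qed.

Lemma bounded_opZ a T : bounded_op T -> bounded_op (a *: T).
Proof.
move=> /bounded_opP[lT [K K0 TK]]; apply/bounded_opP; split.
  by move=> b x y; rewrite !fctE lT scalerDr !scalerA [a * b]mulrC.
exists (nrm a * K); first by rewrite mulr_ge0// nrm_ge0.
by move=> x; rewrite !fctE nrmZ -mulrA ler_wpM2l// nrm_ge0.
Qed.

Lemma bounded_op0 : bounded_op (0 : H -> H).
Proof.
apply/bounded_opP; split.
  by move=> a x y; rewrite -[LHS]/0 -[X in _ *: X]/0 -[X in _ + X]/0 scaler0 addr0.
by exists 0 => // x; rewrite -[X in nrm X]/0 nrm0 mul0r.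
Qed.

End Operator.

(** * Orthonormal systems *)

Section Orthonormal.
Context {R : realType} {H : hilbertType R}.
Implicit Types (x y : H) (e f : nat -> H) (c d : nat -> R[i]) (r : seq nat).

(* As in [orthonormal_basis], terms equal to 0 are allowed. *)
Definition orthonormal_sys e : Prop :=
  (forall m n, m != n -> '[e m, e n] = 0) /\ (forall n, e n = 0 \/ `|e n| = 1).

Lemma onb_sys e : orthonormal_basis e -> orthonormal_sys e.
Proof. by case. Qed.

Lemma nrm_sys e n : orthonormal_sys e -> nrm (e n) = 0 \/ nrm (e n) = 1.
Proof. by move=> [_ /(_ n)[->|]]; [left; rewrite nrm0|rewrite /nrm=> ->; right]. Qed.

Lemma nrm_sys_le1 e n : orthonormal_sys e -> nrm (e n) <= 1.
Proof. by move=> /nrm_sys-/(_ n)[]->. Qed.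

(** The coefficient ['[e n, e n]] is 0 or 1, and it is 0 only where the vector vanishes; this is how
    zero terms are absorbed in the formulas. *)
Lemma dot_sys e n : orthonormal_sys e -> '[e n, e n] *: e n = e n.
Proof.
rewrite dotxx => /nrm_sys-/(_ n)[h|->]; last by rewrite expr1n scale1r.
by rewrite (nrm_eq0 h) scaler0.
Qed.

Lemma dot_sysM e n x : orthonormal_sys e -> '[x, e n] * '[e n, e n] = '[x, e n].
Proof.
move=> oe; rewrite -[in RHS](dot_sys n oe) dotZr mulrC; congr (_ * _).
exact: dotC.
Qed.

Lemma nrm_sqr_sum_sys e c r : orthonormal_sys e -> uniq r ->
  nrm (\sum_(i <- r) c i *: e i) ^+ 2 = \sum_(i <- r) (nrm (c i) * nrm (e i)) ^+ 2.
Proof.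
move=> oe; elim: r => [|a r ih] /=; first by rewrite !big_nil nrm0 expr0n.
move=> /andP[ar ur]; rewrite !big_cons nrm_sqrD ih// nrmZ.
rewrite dot_sumr big_seq big1 ?mul0rn ?addr0// => i ir.
rewrite dotZr dotZl oe.1 ?mulr0//.
by apply: contraNneq ar => ->.
Qed.

Lemma nrm_sqr_sum_le e c r : orthonormal_sys e -> uniq r ->
  nrm (\sum_(i <- r) c i *: e i) ^+ 2 <= \sum_(i <- r) nrm (c i) ^+ 2.
Proof.
move=> oe ur; rewrite nrm_sqr_sum_sys// ler_sum// => i _.
rewrite exprMn ler_piMr ?sqr_ge0// expr_le1 ?nrm_ge0//.
exact: nrm_sys_le1.
Qed.

Lemma bessel e x r : orthonormal_sys e -> uniq r ->
  \sum_(i <- r) nrm '[x, e i] ^+ 2 <= nrm x ^+ 2.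
Proof.
move=> oe ur; set P := \sum_(i <- r) '[x, e i] *: e i.
have := sqr_ge0 (nrm (x - P)); rewrite nrm_sqrB.
have -> : complex.Re '[x, P] = \sum_(i <- r) nrm '[x, e i] ^+ 2.
  rewrite dot_sumr Re_sum; apply: eq_bigr => i _.
  by rewrite dotZr mulrC -nrm_sqr.
have := nrm_sqr_sum_le (fun i => '[x, e i]) oe ur; rewrite -/P; lra.
Qed.

Lemma bessell e x r : orthonormal_sys e -> uniq r ->
  \sum_(i <- r) nrm '[e i, x] ^+ 2 <= nrm x ^+ 2.
Proof.
move=> oe ur; apply: le_trans (bessel x oe ur).
by apply: ler_sum => i _; rewrite dotC nrm_conjc.
Qed.

(** By orthogonality, the squared distance of two partial sums is at most an increment of the
    bounded monotone series of squares. *)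
Lemma riesz_fischer e c (M : R) : orthonormal_sys e ->
  (forall n, \sum_(0 <= i < n) nrm (c i) ^+ 2 <= M) ->
  cvgn (series (fun i => c i *: e i)).
Proof.
move=> oe cM; pose v i := nrm (c i) ^+ 2.
have nv : nondecreasing_seq (series v).
  by apply: nondecreasing_series => i _ _; rewrite sqr_ge0.
have cv : cvgn (series v).
  by apply: nondecreasing_is_cvgn => //; exists M => _ [n _ <-]; exact: cM.
apply: cauchy_nrmP => eps e0.
have /cvgrPdist_lt/(_ (eps ^+ 2)) := cv.
move=> /(_ (exprn_gt0 _ e0))[N _ hN]; exists N => m n Nm mn.
have := hN m Nm; rewrite /= ger0_norm ?subr_ge0 ?nondecreasing_cvgn_le// => hm.
rewrite sub_series mn -(@ltr_pXn2r _ 2) ?nnegrE ?nrm_ge0 ?(ltW e0)//.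
rewrite (le_lt_trans (nrm_sqr_sum_le _ oe (iota_uniq _ _)))//.
apply: le_lt_trans hm.
have -> : \sum_(i <- iota m (n - m)) nrm (c i) ^+ 2 = series v n - series v m.
  by rewrite sub_series mn.
by rewrite lerD2r nondecreasing_cvgn_le.
Qed.

Definition bounded_coeff c := exists2 K : R, 0 <= K & forall n, nrm (c n) <= K.

(** The operator sum_n c_n <., e_n> f_n. For [f = e] it is diagonal, and the square roots and powers
    below are built this way. *)
Definition sop c e f x : H := limn (series (fun n => (c n * '[x, e n]) *: f n)).

Lemma sop_cvg c e f x :
  bounded_coeff c -> orthonormal_sys e -> orthonormal_sys f ->
  series (fun n => (c n * '[x, e n]) *: f n) @ \oo --> sop c e f x.
Proof.
move=> [K K0 cK] oe of_; apply: (@riesz_fischer _ _ (K ^+ 2 * nrm x ^+ 2)) => // n.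
apply: le_trans (ler_wpM2l (sqr_ge0 K) (bessel x oe (iota_uniq 0 (n - 0)))).
rewrite mulr_sumr; apply: ler_sum => i _.
by rewrite nrmM exprMn ler_wpM2r ?sqr_ge0// lerXn2r ?nnegrE ?nrm_ge0.
Qed.

Lemma sop_dot_cvg c e f x y :
  bounded_coeff c -> orthonormal_sys e -> orthonormal_sys f ->
  (\sum_(0 <= n < N) c n * '[x, e n] * '[f n, y] : R[i]^o) @[N --> \oo]
    --> ('[sop c e f x, y] : R[i]^o).
Proof.
move=> bc oe of_; have /(cvg_dotl (y := y)) := (sop_cvg (x := x) bc oe of_).
move/cvg_ext; apply => N.
by rewrite /series/= dot_suml; apply: eq_bigr => i _; rewrite dotZl.
Qed.

Lemma limC_unique (u : nat -> R[i]^o) (a b : R[i]^o) :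
  u @ \oo --> a -> u @ \oo --> b -> a = b.
Proof. exact: cvg_unique. Qed.

Lemma sop_dot c e f x m :
  bounded_coeff c -> orthonormal_sys e -> orthonormal_sys f ->
  '[sop c e f x, f m] = c m * '[x, e m] * '[f m, f m].
Proof.
move=> bc oe of_; apply: limC_unique (sop_dot_cvg bc oe of_) _.
apply: cvg_near_cst; near=> N; rewrite (bigD1_seq m) ?iota_uniq//=; last first.
  by rewrite mem_index_iota; near: N; exists m.+1.
by rewrite big1 ?addr0// => i im; rewrite of_.1 ?mulr0.
Unshelve. all: by end_near. Qed.

Lemma bounded_coeff_conj c : bounded_coeff c -> bounded_coeff (fun n => conjc (c n)).
Proof. by move=> [K K0 cK]; exists K => // n; rewrite nrm_conjc. Qed.

Lemma sop_adj c e f x y :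
  bounded_coeff c -> orthonormal_sys e -> orthonormal_sys f ->
  '[sop c e f x, y] = '[x, sop (fun n => conjc (c n)) f e y].
Proof.
move=> bc oe of_; apply: limC_unique (sop_dot_cvg bc oe of_) _.
have /(cvg_dotr (y := x)) := (sop_cvg (x := y) (bounded_coeff_conj bc) of_ oe).
move/cvg_ext; apply => N.
rewrite /series/= dot_sumr; apply: eq_bigr => i _.
by rewrite dotZr conjcM conjcK -dotC mulrAC.
Qed.

Lemma sop_bounded c e f :
  bounded_coeff c -> orthonormal_sys e -> orthonormal_sys f ->
  bounded_op (sop c e f).
Proof.
move=> bc oe of_; apply/bounded_opP; split.
  (* Linearity comes from the existence of an adjoint, without passing to the limit in sums. *)
  move=> a x y; apply: dot_ext => z.
  by rewrite dotDl dotZl !sop_adj// dotDl dotZl.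
have [K K0 cK] := bc; exists K => // x.
have /cvg_nrm h := (sop_cvg (x := x) bc oe of_).
apply: (cvgr_to_le h); near=> N.
rewrite -(@ler_pXn2r _ 2) ?nnegrE ?nrm_ge0 ?mulr_ge0 ?nrm_ge0//.
rewrite (le_trans (nrm_sqr_sum_le _ of_ (iota_uniq _ _)))// exprMn.
apply: le_trans (ler_wpM2l (sqr_ge0 K) (bessel x oe (iota_uniq 0 (N - 0)))).
rewrite mulr_sumr; apply: ler_sum => i _.
by rewrite nrmM exprMn ler_wpM2r ?sqr_ge0// lerXn2r ?nnegrE ?nrm_ge0.
Unshelve. all: by end_near. Qed.

Lemma sop_sys c e f m : bounded_coeff c -> orthonormal_sys e -> orthonormal_sys f ->
  sop c e f (e m) = (c m * '[e m, e m]) *: f m.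
Proof.
move=> bc oe of_; apply: dot_ext => z.
apply: limC_unique (sop_dot_cvg bc oe of_) _.
apply: cvg_near_cst; near=> N; rewrite (bigD1_seq m) ?iota_uniq//=; last first.
  by rewrite mem_index_iota; near: N; exists m.+1.
by rewrite big1 ?addr0 ?dotZl// => i im; rewrite oe.1 ?mulr0 ?mul0r// eq_sym.
Unshelve. all: by end_near. Qed.

Lemma bounded_coeff1 : bounded_coeff (fun=> 1).
Proof. by exists 1 => // n; rewrite /nrm normr1. Qed.

Lemma fourier e x : orthonormal_basis e ->
  series (fun n => '[x, e n] *: e n) @ \oo --> x.
Proof.
move=> be; have oe := onb_sys be; have b1 := bounded_coeff1.
have := sop_cvg (x := x) b1 oe oe; rewrite (_ : sop _ _ _ x = x).
  by move/cvg_ext; apply => N;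
     apply: eq_bigr => i _; rewrite mul1r.
(* The difference is orthogonal to every [e n], and the family is total. *)
apply/eqP; rewrite -subr_eq0; apply/eqP; case: be => _ _; apply => n.
by rewrite dotBl sop_dot// mul1r dot_sysM// subrr.
Qed.

Lemma fourier_op (T : H -> H) e x : bounded_op T -> orthonormal_basis e ->
  series (fun n => '[x, e n] *: T (e n)) @ \oo --> T x.
Proof.
move=> bT be; have /(bounded_op_cvg bT) := fourier (x := x) be.
move/cvg_ext; apply => N.
rewrite /series/= (linop_sum bT.1); apply: eq_bigr => i _.
by rewrite (linopZ bT.1).
Qed.

Lemma fourier_dot (T : H -> H) e x y : bounded_op T -> orthonormal_basis e ->
  (\sum_(0 <= n < N) '[x, e n] * '[T (e n), y] : R[i]^o) @[N --> \oo]
    --> ('[T x, y] : R[i]^o).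
Proof.
move=> bT be; have /(cvg_dotl (y := y)) := (fourier_op (x := x) bT be).
move/cvg_ext; apply => N.
by rewrite /series/= dot_suml; apply: eq_bigr => i _; rewrite dotZl.
Qed.

Lemma onb_ext (T S : H -> H) e : bounded_op T -> bounded_op S ->
  orthonormal_basis e -> (forall n, T (e n) = S (e n)) -> T = S.
Proof.
move=> bT bS be TS; apply/funext => x; apply: dot_ext => y.
apply: limC_unique (fourier_dot (x := x) (y := y) bT be) _.
have := fourier_dot (x := x) (y := y) bS be; move/cvg_ext; apply => N.
by apply: eq_bigr => i _; rewrite TS.
Qed.

Lemma onb_ext_dot x y e : orthonormal_basis e ->
  (forall n, '[x, e n] = '[y, e n]) -> x = y.
Proof.
move=> [_ _ te] h; apply/eqP; rewrite -subr_eq0; apply/eqP/te => n.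
by rewrite dotBl h subrr.
Qed.

Lemma parseval e x : orthonormal_basis e ->
  series (fun n => nrm '[x, e n] ^+ 2) @ \oo --> nrm x ^+ 2.
Proof.
move=> be.
have b1 : bounded_op (@id H) by split=> // z; exact: cvg_id.
have /cvg_Re := (fourier_dot (x := x) (y := x) b1 be); rewrite -nrm_dotE.
move/cvg_ext; apply => N.
rewrite Re_sum; apply: eq_bigr => i _.
by rewrite [X in _ * X]dotC -nrm_sqr.
Qed.

(** [S y] is summed from its Fourier coefficients ['[y, T (e n)]]. They are square summable: if [s]
    is a partial sum of their squares and [z] the matching partial sum of vectors, then s = <y, T z>
    and |z|^2 <= s, hence s^2 <= (K |y|)^2 s. *)
Lemma adjoint_exists (T : H -> H) e : bounded_op T -> orthonormal_basis e ->
  exists2 S, bounded_op S & forall x y, '[T x, y] = '[x, S y].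
Proof.
move=> bT be; have oe := onb_sys be.
have [lT [K K0 TK]] := (bounded_opP T).1 bT.
have bnd y n : \sum_(0 <= i < n) nrm '[y, T (e i)] ^+ 2 <= (K * nrm y) ^+ 2.
  set z := \sum_(0 <= i < n) '[y, T (e i)] *: e i; set s := (X in X <= _).
  have zs : nrm z ^+ 2 <= s by apply: nrm_sqr_sum_le => //; exact: iota_uniq.
  have sE : s%:C = '[y, T z].
    rewrite (linop_sum lT) dot_sumr realc_sum; apply: eq_bigr => i _.
    by rewrite (linopZ lT) dotZr nrm_sqr mulrC.
  have s0 : 0 <= s by apply: sumr_ge0 => i _; exact: sqr_ge0.
  have sz : s <= nrm y * K * nrm z.
    have := nrm_dot y (T z); rewrite -sE nrm_real ger0_norm// => /le_trans; apply.
    by rewrite -mulrA ler_wpM2l ?nrm_ge0.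
  have [->|sn0] := eqVneq s 0; first exact: sqr_ge0.
  have {sn0}sp : 0 < s by rewrite lt_neqAle eq_sym sn0.
  have : s ^+ 2 <= (K * nrm y) ^+ 2 * s.
    apply: le_trans (ler_wpM2l (sqr_ge0 _) zs); rewrite -exprMn.
    by rewrite lerXn2r ?nnegrE ?mulr_ge0 ?nrm_ge0// [K * _]mulrC.
  by rewrite expr2 ler_pM2r.
pose S y := limn (series (fun n => '[y, T (e n)] *: e n)).
have cS y : series (fun n => '[y, T (e n)] *: e n) @ \oo --> S y.
  by apply: (riesz_fischer oe (bnd y)).
have aS x y : '[T x, y] = '[x, S y].
  apply: limC_unique (fourier_dot (x := x) (y := y) bT be) _.
  have /(cvg_dotr (y := x)) := cS y; move/cvg_ext; apply => N.
  rewrite /series/= dot_sumr; apply: eq_bigr => i _.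
  by rewrite dotZr -dotC mulrC.
exists S => //; apply/bounded_opP; split.
  move=> a x y; apply: dot_extr => z.
  by rewrite dotDr dotZr -!aS dotDr dotZr.
exists K => // y.
have /cvg_nrm h := (cS y).
apply: (cvgr_to_le h); near=> N.
rewrite -(@ler_pXn2r _ 2) ?nnegrE ?nrm_ge0 ?mulr_ge0 ?nrm_ge0//.
exact: le_trans (nrm_sqr_sum_le _ oe (iota_uniq _ _)) (bnd y N).
Unshelve. all: by end_near. Qed.

End Orthonormal.

Lemma fmap_ultra X Y (f : X -> Y) (F : set_system X) :
  UltraFilter F -> UltraFilter (f @ F).
Proof.
move=> FU; split; first exact: fmap_proper_filter.
move=> G PG FG; apply/seteqP; split=> [B GB|]; last exact: FG.
have [//|Fn] := in_ultra_setVsetC (f @^-1` B) FU.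
have /FG GnB : (f @ F) (~` B) by [].
by have [x []] := filter_ex (filterI GB GnB).
Qed.

(** * Compact operators and the spectral theorem *)

Section Compactoid.
Context {R : realType} {H : hilbertType R}.
Implicit Types (x y : H) (T S P : H -> H).

Definition selfadjoint T := forall x y, '[T x, y] = '[x, T y].

(** Since <P z, z> is real, polarizing at z = x + y equates the imaginary parts of <P x, y> and <x,
    P y>; replacing x by i x equates the real parts. *)
Lemma positive_selfadjoint P : positive_op P -> selfadjoint P.
Proof.
move=> [[lP _] P0].
have Im0 x : complex.Im '[P x, x] = 0 by exact: ger0_Im.
have ImD (a b : R[i]) : complex.Im (a + b) = complex.Im a + complex.Im b.
  by case: a b => [? ?] [].
have key x y : complex.Im '[P x, y] = complex.Im '[x, P y].
  have := Im0 (x + y); rewrite (linopD lP) !dotDl !dotDr !ImD !Im0 add0r addr0.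
  rewrite ['[x, P y]]dotC; case: '[P x, y] => a b; case: '[P y, x] => c d /=.
  by move/eqP; rewrite addr_eq0 => /eqP.
have Rei (a : R[i]) : complex.Re a = complex.Im ('i%C * a).
  by case: a => u v /=; rewrite mul0r mul1r add0r.
move=> x y; apply/eqP; rewrite eq_complex key eqxx andbT.
by rewrite !Rei -!dotZl -(linopZ lP) key.
Qed.

Lemma positive_Re P x : positive_op P -> '[P x, x] = (complex.Re '[P x, x])%:C.
Proof. by move=> [_ P0]; rewrite RRe_real// ger0_real. Qed.

Lemma positive_Re_ge0 P x : positive_op P -> 0 <= complex.Re '[P x, x].
Proof. by move=> pP; rewrite -ler0c -positive_Re//; case: pP. Qed.

Lemma cauchy_filter (V : completeNormedModType R[i]) (G : set_system V)
    {PG : ProperFilter G} :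
  (forall e : R, 0 < e -> exists z, G [set y | nrm (y - z) < e]) -> cvg G.
Proof.
move=> h; apply/cauchy_cvgP/cauchyP => _/posnumP[e].
have [z Gz] : exists z, G [set y | nrm (y - z) < complex.Re e%:num].
  by apply: h; have := [gt0 of e%:num]; rewrite ltcE => /andP[].
exists z; apply: filterS Gz => y /= yz.
rewrite -ball_normE /= distrC nrmE.
have -> : e%:num = (complex.Re e%:num)%:C by rewrite RRe_real// ger0_real.
by rewrite ltcR.
Qed.

(* Compactness by ultrafilters: unlike with sequences, no subsequence has to be
   extracted, so that sums and products of operators are immediate. *)
Definition compactoid T := forall F : set_system H, UltraFilter F ->
  F [set x | nrm x <= 1] -> cvg (T @ F).

Lemma compact_op_compactoid T : compact_op T -> compactoid T.
Proof.
move=> [bT]; rewrite precompactE compact_ultra => cT F FU F1.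
have FT : (T @ F) (closure (T @` [set x | `|x| <= 1])).
  have F2 : F (T @^-1` closure (T @` [set x | `|x| <= 1])).
    apply: filterS F1 => x x1; apply: subset_closure; exists x => //=.
    by rewrite nrmE -[1]/(1%:C) lecR.
  exact: F2.
have [] := cT (T @ F) (fmap_ultra T FU) FT.
by move=> l [_ Tl]; apply/cvg_ex; exists l.
Qed.

Lemma compactoidD T S : compactoid T -> compactoid S -> compactoid (T + S).
Proof.
move=> cT cS F FU F1; apply/cvg_ex; exists (lim (T @ F) + lim (S @ F)).
exact: (cvgD (cT F FU F1) (cS F FU F1)).
Qed.

Lemma compactoid_compl T S : bounded_op T -> compactoid S -> compactoid (T \o S).
Proof.
move=> bT cS F FU F1; apply/cvg_ex; exists (T (lim (S @ F))).
exact: (bounded_op_cvg bT (cS F FU F1)).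
Qed.

Lemma compactoidZ a T : compactoid T -> compactoid (a *: T).
Proof.
move=> cT F FU F1; apply/cvg_ex; exists (a *: lim (T @ F)).
exact: (cvgZl_tmp (cT F FU F1)).
Qed.

Lemma compactoid_compr T S : bounded_op S -> compactoid S -> bounded_op T ->
  compactoid (S \o T).
Proof.
move=> bS cS /bounded_opP[lT [K K0 TK]] F FU F1.
(* Scaling by [k] brings the image of the unit ball under [T] back into the unit ball; K + 1 is
   nonzero even if K = 0. *)
pose k := (K + 1)^-1%:C : R[i].
have k0 : k != 0.
  rewrite /k (fmorph_eq0 (real_complex R)) invr_eq0 gt_eqF//.
  by rewrite ltr_wpDl.
have F2 : F [set x | nrm (k *: T x) <= 1].
  apply: filterS F1 => x /= x1; rewrite nrmZ nrm_real.
  rewrite ger0_norm ?invr_ge0 ?addr_ge0// ler_pdivrMl ?ltr_wpDl// mulr1.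
  rewrite (le_trans (TK x))// (le_trans (ler_piMr K0 x1))// lerDl.
  exact: ler01.
have Gc : cvg (S @ ((fun x => k *: T x) @ F)) := cS _ (fmap_ultra _ FU) F2.
have /(cvgZl_tmp (k := k^-1)) h : (fun x => S (k *: T x)) @ F -->
  lim (S @ ((fun x => k *: T x) @ F)) by exact: Gc.
apply/cvg_ex; eexists; apply: cvg_ext h _ => x /=.
by rewrite (linopZ bS.1) scalerA mulVf// scale1r.
Qed.

(* |T x - T y|^2 = <x - y, S (T x) - S (T y)>. *)
Lemma compactoid_sqr T S : linear T -> (forall x y, '[T x, T y] = '[x, S (T y)]) ->
  compactoid (S \o T) -> compactoid T.
Proof.
move=> lT TS cST F FU F1; apply: cauchy_filter => e e0.
(* Two values within e^2/8 of the limit are less than e^2/4 apart; as |x - x0| <= 2 in the unit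
   ball, the squared distance of the images under [T] stays below e^2/2. *)
have /cvg_nrmP/cvgrPdist_lt/(_ (e ^+ 2 / 8)) := cST F FU F1.
have e8 : 0 < e ^+ 2 / 8 by rewrite divr_gt0// exprn_gt0.
move=> /(_ e8) h.
pose l := lim ((S \o T) @ F).
have FA : F ([set x | nrm x <= 1] `&` [set t | nrm (S (T t) - l) < e ^+ 2 / 8]).
  apply: filterI => //; apply: filterS h => t.
  by rewrite sub0r normrN ger0_norm ?nrm_ge0.
have [x0 [x01 hx0]] := filter_ex FA; exists (T x0).
suff : F [set x | nrm (T x - T x0) < e] by [].
apply: filterS FA => x /= [x1 hx].
have d : nrm (S (T x) - S (T x0)) < e ^+ 2 / 4.
  have -> : S (T x) - S (T x0) = (S (T x) - l) + (l - S (T x0)).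
    by rewrite addrA subrK.
  have := ler_nrmD (S (T x) - l) (l - S (T x0)); rewrite [nrm (l - _)]nrmC.
  by move: hx hx0 => /=; lra.
rewrite -(@ltr_pXn2r _ 2) ?nnegrE ?nrm_ge0 ?(ltW e0)// nrm_dotE.
have -> : '[T x - T x0, T x - T x0] = '[x - x0, S (T x) - S (T x0)].
  by rewrite !dotBl !dotBr !TS.
apply: le_lt_trans (Re_le_nrm _) _; apply: le_lt_trans (nrm_dot _ _) _.
have xx : nrm (x - x0) <= 2.
  by apply: le_trans (ler_nrmD _ _) _; rewrite nrmN; move: x01 x1 => /=; lra.
apply: (le_lt_trans (ler_wpM2r (nrm_ge0 _) xx)).
have := exprn_gt0 2 e0; lra.
Qed.

End Compactoid.

(** * The spectral theorem for positive compact operators *)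

Section Spectral.
Context {R : realType} {H : hilbertType R}.
Implicit Types (x y : H) (P : H -> H) (E : set H).

Definition orthocompl E : set H := [set x | forall e, E e -> '[x, e] = 0].

Lemma orthocomplZ E x a : orthocompl E x -> orthocompl E (a *: x).
Proof. by move=> Ex e Ee; rewrite dotZl Ex// mulr0. Qed.

(* Expand 0 <= <P z, z> at z = x - P x / m. *)
Lemma positive_nrm_sqr P E (m : R) x : positive_op P -> 0 < m ->
  (forall z, orthocompl E z -> orthocompl E (P z)) ->
  (forall z, orthocompl E z -> complex.Re '[P z, z] <= m * nrm z ^+ 2) ->
  orthocompl E x -> nrm (P x) ^+ 2 <= m * complex.Re '[P x, x].
Proof.
move=> pP m0 EP qm Ex; have saP := positive_selfadjoint pP.
have lP := pP.1.1.
have := positive_Re_ge0 (x - (m^-1)%:C *: P x) pP.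
rewrite (linopB lP) (linopZ lP) !(dotBl, dotBr, dotZl, dotZr) conjc_real.
rewrite (saP (P x) x) !(ReB, ReZ) -nrm_dotE.
have := qm _ (EP _ Ex); set n := nrm (P x) ^+ 2.
set q := complex.Re '[P x, x]; set r := complex.Re '[P (P x), P x].
move=> rn h.
have {}h : 0 <= q - n / m *+ 2 + r / m ^+ 2.
  apply: le_trans h _; rewrite le_eqVlt; apply/orP; left; apply/eqP.
  by field; rewrite gt_eqF.
have : r / m ^+ 2 <= n / m.
  rewrite ler_pdivrMr ?exprn_gt0// expr2 mulrA divfK ?gt_eqF//.
  by rewrite mulrC.
rewrite mulr2n in h => h2; have : n / m <= q by lra.
by rewrite ler_pdivrMr// mulrC.
Qed.

(* Let m be the supremum of <P x, x> over the unit ball of [orthocompl E]. Along a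
   maximizing sequence |P x - m x|^2 <= m (m - <P x, x>) tends to 0, and by
   compactness P x, hence x, converges along an ultrafilter. *)
Lemma eigen_max P E : positive_op P -> compactoid P ->
  (forall z, orthocompl E z -> orthocompl E (P z)) ->
  (exists2 x, orthocompl E x & P x <> 0) ->
  exists (t : R) v, [/\ orthocompl E v, v <> 0 & P v = t%:C *: v].
Proof.
move=> pP cP EP [x0 Ex0 Px0]; have [lP [K K0 PK]] := (bounded_opP P).1 pP.1.
pose q x := complex.Re '[P x, x].
pose A := [set q x | x in [set x | orthocompl E x /\ nrm x <= 1]].
have qK x : q x <= K * nrm x ^+ 2.
  apply: le_trans (Re_le_nrm _) _; apply: le_trans (nrm_dot _ _) _.
  by rewrite expr2 mulrA ler_wpM2r ?nrm_ge0.
have q0 : q 0 = 0 by rewrite /q (linop0 lP) dot0l.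
have qZ a x : q (a *: x) = nrm a ^+ 2 * q x.
  by rewrite /q (linopZ lP) dotZl dotZr mulrA -nrm_sqr ReZ.
have E0 : orthocompl E 0 by move=> e _; rewrite dot0l.
have supA : has_sup A.
  split; first by exists 0; exists 0 => //; split=> //=; rewrite nrm0.
  exists K => _ [x [_ x1] <-]; apply: le_trans (qK x) _.
  by rewrite ler_piMr// expr_le1 ?nrm_ge0.
set m := sup A.
have qm x : orthocompl E x -> q x <= m * nrm x ^+ 2.
  move=> Ex; have [x0'|xn0] := eqVneq (nrm x) 0.
    by rewrite (nrm_eq0 x0') q0 nrm0 expr0n mulr0.
  have : q ((nrm x)^-1%:C *: x) <= m.
    apply: sup_upper_bound => //; exists ((nrm x)^-1%:C *: x) => //.
    split; first exact: orthocomplZ.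
    by rewrite nrmZ nrm_real ger0_norm ?invr_ge0 ?nrm_ge0// mulVf.
  rewrite qZ nrm_real ger0_norm ?invr_ge0 ?nrm_ge0// exprVn.
  by rewrite ler_pdivrMl ?exprn_gt0 ?lt_neqAle 1?eq_sym ?xn0 ?nrm_ge0// mulrC.
(* If m <= 0, the form is at most 0 on the complement, and [positive_nrm_sqr] with the bound 1 gives
   |P x0|^2 <= <P x0, x0> <= 0. *)
have m0 : 0 < m.
  rewrite ltNge; apply/negP => m0; apply: Px0; apply: nrm_eq0.
  have q1 z : orthocompl E z -> q z <= 1 * nrm z ^+ 2.
    by move=> /qm/le_trans; apply; rewrite ler_wpM2r ?sqr_ge0// (le_trans m0).
  have := positive_nrm_sqr pP ltr01 EP q1 Ex0; rewrite mul1r.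
  have := qm _ Ex0; rewrite -/(q x0) => h1 h2.
  have : nrm (P x0) ^+ 2 <= 0.
    apply: le_trans h2 _; apply: le_trans h1 _.
    by rewrite mulr_le0_ge0// sqr_ge0.
  by rewrite le_eqVlt ltNge sqr_ge0 orbF sqrf_eq0 => /eqP.
have ex n : exists x, [/\ orthocompl E x, nrm x <= 1 & m - n.+1%:R^-1 < q x].
  have [||_ [x [Ex x1] <-] h] := @sup_adherent _ A n.+1%:R^-1.
  - by rewrite invr_gt0.
  - exact: supA.
  - by exists x.
have [u hu] := choice ex.
have [F [FU uF]] := ultraFilterLemma (fmap_proper_filter u eventually_filter).
have FE : F (orthocompl E) by apply: uF; exists 0%N => // n _ /=; have [] := hu n.
have F1 : F [set x | nrm x <= 1].
  by apply: uF; exists 0%N => // n _ /=; have [] := hu n.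
have um : q (u n) @[n --> \oo] --> m.
  apply: (@squeeze_cvgr _ _ _ _ (fun n => m - n.+1%:R^-1) (fun=> m)).
  - near=> n; have [Eu u1 /ltW ->] := hu n.
    rewrite (le_trans (qm _ Eu))// ler_piMr ?(ltW m0)// expr_le1 ?nrm_ge0//.
  - rewrite -[X in _ --> X]subr0; apply: cvgB; first exact: cvg_cst.
    exact: cvg_harmonic.
  - exact: cvg_cst.
have qF : q @ F --> m by apply: cvg_trans um => B /= h; exact: (uF (q @^-1` B)).
have wu : (fun n => P (u n) - m%:C *: u n) @ \oo --> (0 : H).
  apply: (@cvg_nrm0_le _ _ _ _ _ _ (fun n => Num.sqrt (m * (m - q (u n))))).
    move=> n; rewrite subr0; have [Eu u1 _] := hu n.
    rewrite -[leLHS]ger0_norm ?nrm_ge0// -sqrtr_sqr ler_wsqrtr//.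
    rewrite nrm_sqrB dotZr conjc_real ReZ -/(q _) nrmZ nrm_real (gtr0_norm m0).
    have := positive_nrm_sqr pP m0 EP qm Eu; rewrite -/(q _) => h.
    have : (m * nrm (u n)) ^+ 2 <= m ^+ 2.
      by rewrite exprMn ler_piMr ?sqr_ge0// expr_le1 ?nrm_ge0.
    rewrite mulrBr -expr2 mulr2n; lra.
  rewrite -[X in _ --> X](_ : Num.sqrt (m * (m - m)) = 0); last first.
    by rewrite subrr mulr0 sqrtr0.
  apply: continuous_cvg; first exact: sqrt_continuous.
  by apply: cvgMl_tmp; apply: cvgB => //; exact: cvg_cst.
have wF : (fun x => P x - m%:C *: x) @ F --> (0 : H).
  by apply: cvg_trans wu => B /= h; exact: (uF ((fun x => P x - m%:C *: x) @^-1` B)).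
have mC : m%:C != 0 :> R[i] by rewrite (fmorph_eq0 (real_complex R)) gt_eqF.
set y := lim (P @ F); have Py : P @ F --> y by exact: cP.
have idF : F --> (m%:C)^-1 *: y.
  have mF : (fun x => m%:C *: x) @ F --> y - 0.
    apply: (cvg_ext (cvgB Py wF)) => x.
    by rewrite -[LHS]/(P x - (P x - m%:C *: x)) opprB addrC subrK.
  rewrite subr0 in mF; apply: (cvg_ext (cvgZl_tmp mF)) => x /=.
  by rewrite scalerA mulVf ?scale1r.
set v := _ *: y in idF.
have Pv : P v = y.
  apply: (@cvg_unique _ _ (P @ F)) => //.
  exact: (bounded_op_cvg pP.1 idF).
exists m, v; split.
- move=> e Ee.
  have h : ('[x, e] : R[i]^o) @[x --> F] --> ('[v, e] : R[i]^o) by apply: cvg_dotl.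
  suff h0 : ('[x, e] : R[i]^o) @[x --> F] --> (0 : R[i]^o).
    exact: (@cvg_unique _ _ _ _ _ _ h h0).
  by apply: cvg_near_cst; apply: filterS FE => x; exact.
(* If v = 0 then y = P v = 0, so q <= |P x| tends to 0 along [F], against m > 0. *)
- move=> v0; move: Pv; rewrite v0 (linop0 lP) => /esym y0.
  have : q @ F --> (0 : R).
    apply: (@squeeze_cvgr _ _ _ _ (fun=> 0) (fun x => nrm (P x - y))).
    - apply: filterS F1 => x x1; rewrite positive_Re_ge0//= y0 subr0.
      apply: le_trans (Re_le_nrm _) _; apply: le_trans (nrm_dot _ _) _.
      by rewrite ler_piMr ?nrm_ge0.
    - exact: cvg_cst.
    - by apply/cvg_nrmP.
  move=> q0'; have m0' : m = 0 by exact: (cvg_unique _ qF q0').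
  by move: m0; rewrite m0' ltxx.
- by rewrite Pv /v scalerA mulfV// scale1r.
Unshelve. all: by end_near. Qed.

Definition unit_orthogonal E := [/\ forall x, E x -> nrm x = 1 &
  forall x y, E x -> E y -> x <> y -> '[x, y] = 0].

(** Two distinct members are at distance sqrt 2 > 1, so points of a countable dense set chosen
    within 1/2 of them are distinct. *)
Lemma unit_orthogonal_countable E : separable H -> unit_orthogonal E -> countable E.
Proof.
move=> [D [/countable_injP[g gD] dD]] [E1 Eo].
have ex x : exists d, D d /\ nrm (x - d) < 1 / 2.
  have h0 : (0 : R[i]) < (1 / 2 : R)%:C by rewrite ltcR.
  have [||d [xd Dd]] := dD (ball x (1 / 2 : R)%:C).
  - by exists x; exact: ballxx.
  - exact: ball_open.
  - by exists d; split=> //; move: xd; rewrite -ball_normE /= nrmE ltcR.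
have [d hd] := choice ex.
apply/countable_injP; exists (g \o d) => x y /set_mem Ex /set_mem Ey /=.
move=> /(gD _ _ (mem_set (hd x).1) (mem_set (hd y).1)) dxy.
apply: contrapT => /(Eo _ _ Ex Ey) xy0.
have : nrm (x - y) < 1.
  have -> : x - y = (x - d x) + (d x - y) by rewrite addrA subrK.
  apply: le_lt_trans (ler_nrmD _ _) _.
  have [_ h1] := hd x; have [_ h2] := hd y; rewrite dxy [X in _ + X]nrmC.
  by rewrite dxy in h1; lra.
rewrite -(@ltr_pXn2r _ 2) ?nnegrE ?nrm_ge0// nrm_sqrB xy0 !E1//= mul0rn !expr1n.
by move/eqP; rewrite subr0 ltNge lerDl ler01.
Qed.

(* A maximal orthonormal set of eigenvectors is total, because its orthogonal
   complement is invariant and would otherwise contain a further eigenvector. *)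
Lemma spectral P : separable H -> positive_op P -> compactoid P ->
  exists e (t : nat -> R), [/\ orthonormal_basis e, forall n, 0 <= t n,
    forall n, e n = 0 -> t n = 0 & forall n, P (e n) = (t n)%:C *: e n].
Proof.
move=> sH pP cP.
pose eig := [set E : set H | unit_orthogonal E /\
   forall x, E x -> exists t : R, P x = t%:C *: x].
have lP := pP.1.1; have saP := positive_selfadjoint pP.
have [F Fe totF|E [[[E1 Eo] Ee] Emax]] := @Zorn_bigcup H eig.
  split; first split.
  - by move=> x [X FX Xx]; have [[+ _] _] := Fe _ FX; exact.
  - move=> x y [X FX Xx] [Y FY Yy].
    have [XY|YX] := totF _ _ FX FY.
      by have [[_ +] _] := Fe _ FY; apply=> //; exact: XY.
    by have [[_ +] _] := Fe _ FX; apply=> //; exact: YX.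
  - by move=> x [X FX Xx]; have [_ +] := Fe _ FX; exact.
have add v (t : R) : orthocompl E v -> P v = t%:C *: v -> v = 0.
  move=> Ev Pv; apply: contrapT => v0.
  have nv : nrm v != 0 by apply/eqP => /nrm_eq0.
  pose w := (nrm v)^-1%:C *: v.
  have w1 : nrm w = 1.
    by rewrite nrmZ nrm_real ger0_norm ?invr_ge0 ?nrm_ge0// mulVf.
  have Ew : orthocompl E w by exact: orthocomplZ.
  have nEw : ~ E w.
    move=> /Ew; rewrite dotxx w1 expr1n => /eqP.
    by rewrite (fmorph_eq0 (real_complex R)) oner_eq0.
  apply: (Emax (E `|` [set w])).
    split; first by move=> x; left.
    by move=> h; apply: nEw; apply: h; right.
  split; first split.
  - by move=> x [/E1//|->].
  - move=> x y [Ex|->] [Ey|->] //; first exact: Eo.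
      by rewrite dotC Ew// conjc0.
    by rewrite Ew.
  - move=> x [/Ee//|->]; exists t.
    by rewrite /w (linopZ lP) Pv !scalerA mulrC.
have tot x : orthocompl E x -> x = 0.
  move=> Ex; apply: contrapT => x0.
  have EP z : orthocompl E z -> orthocompl E (P z).
    move=> Ez e /[dup] Ee' /Ee[t Pe]; rewrite saP Pe dotZr Ez// mulr0//.
  have [ex|nex] := pselect (exists2 x, orthocompl E x & P x <> 0).
    by have [t [v [Ev v0 Pv]]] := eigen_max pP cP EP ex; apply: v0; exact: add Pv.
  (* Here [P] vanishes on the complement, so [x] itself is an eigenvector for 0. *)
  apply: x0; apply: (add x 0) => //; rewrite scale0r.
  by apply: contrapT => Px; apply: nex; exists x.
have /countable_injP[g gE] := unit_orthogonal_countable sH (conj E1 Eo).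
(* The injection [g] need not reach every index; at the missed ones [e n] takes the default value 0,
   which [orthonormal_basis] allows. *)
pose e n := xget (0 : H) [set x | E x /\ g x = n].
have eP n : (E (e n) /\ g (e n) = n) \/ e n = 0.
  rewrite /e; case: xgetP => [x _ [Ex gx]|]; [left|right] => //.
have ex n : exists t : R, [/\ 0 <= t, e n = 0 -> t = 0 & P (e n) = t%:C *: e n].
  have [[En _]|e0] := eP n; last by exists 0; rewrite e0 (linop0 lP) scaler0.
  have [t Pe] := Ee _ En; exists t; split=> //.
    have := pP.2 (e n); rewrite Pe dotZl dotxx E1// expr1n mulr1 ler0c//.
  move=> e0; have := E1 _ En; rewrite e0 nrm0 => /eqP.
  by rewrite eq_sym oner_eq0.
have [t ht] := choice ex.
exists e, t; split; [split| | |].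
- move=> m n mn; have [[Em gm]|->] := eP m; last by rewrite dot0l.
  have [[En gn]|->] := eP n; last by rewrite dot0r.
  by apply: Eo => // emn; move: mn; rewrite -gm emn gn eqxx.
- move=> n; have [[En _]|->] := eP n; last by left.
  by right; rewrite nrmE E1.
- move=> x h; apply: tot => y Ey; rewrite -[y](_ : e (g y) = y) ?h//.
  rewrite /e; case: xgetP => [z _ [Ez gz]|/(_ y)[]//].
  by apply: gE => //; exact: mem_set.
- by move=> n; have [] := ht n.
- by move=> n; have [] := ht n.
- by move=> n; have [] := ht n.
Qed.

(** An eigenbasis of the zero operator will do. *)
Lemma onb_exists : separable H -> exists e : nat -> H, orthonormal_basis e.
Proof.
move=> sH; have [||e [t [be _ _ _]]] := @spectral 0 sH; last by exists e.
- split; first exact: bounded_op0.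
  by move=> x; rewrite -['[_, _]]/'[0, x] dot0l.
- move=> F FU _; apply/cvg_ex; exists 0; exact: cvg_cst.
Qed.

End Spectral.

Section RealSeries.
Context {R : realType}.
Implicit Types u : nat -> R.

Lemma nneg_series_cvg u (M : R) : (forall n, 0 <= u n) ->
  (forall n, \sum_(0 <= i < n) u i <= M) ->
  cvgn (series u) /\ limn (series u) <= M.
Proof.
move=> u0 uM; have cu : cvgn (series u).
  apply: nondecreasing_is_cvgn; last by exists M => _ [n _ <-]; exact: uM.
  by apply: nondecreasing_series.
by split=> //; apply: limr_le => //; near=> n; exact: uM.
Unshelve. all: by end_near. Qed.

Lemma nneg_series_le u (l : R) n : (forall n, 0 <= u n) ->
  series u @ \oo --> l -> \sum_(0 <= i < n) u i <= l.
Proof.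
move=> u0 ul; rewrite -(cvg_lim _ ul)//.
apply: (@nondecreasing_cvgn_le _ (series u)); last by apply/cvg_ex; exists l.
by apply: nondecreasing_series.
Qed.

End RealSeries.

(** * Square roots, powers and traces *)

Section Diagonal.
Context {R : realType} {H : hilbertType R}.
Implicit Types (x y : H) (e f : nat -> H) (T S P Q : H -> H) (t : nat -> R).

Definition real_coeff t : nat -> R[i] := fun n => (t n)%:C.

(** The third condition keeps the zero terms of [e] from contributing to the sums of powers of
    [t]. *)
Definition eigenbasis P e t := [/\ orthonormal_basis e, forall n, 0 <= t n,
  forall n, e n = 0 -> t n = 0 & forall n, P (e n) = (t n)%:C *: e n].

Lemma eigenbasis_bounded P e t : bounded_op P -> eigenbasis P e t ->
  exists2 K : R, 0 <= K & forall n, t n <= K.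
Proof.
move=> /bounded_opP[_ [K K0 PK]] [be t0 et Pe]; exists K => // n.
have [e0|e1] := nrm_sys n (onb_sys be); first by rewrite (et _ (nrm_eq0 e0)).
by have := PK (e n); rewrite Pe nrmZ e1 !mulr1 nrm_real ger0_norm.
Qed.

Lemma real_coeff_bounded t (K : R) :
  (forall n, 0 <= t n) -> (forall n, t n <= K) -> bounded_coeff (real_coeff t).
Proof.
move=> t0 tK; exists K; first exact: le_trans (t0 0%N) (tK 0%N).
by move=> n; rewrite nrm_real ger0_norm.
Qed.

Lemma sop_diag c e n : bounded_coeff c -> orthonormal_sys e ->
  sop c e e (e n) = c n *: e n.
Proof. by move=> bc oe; rewrite sop_sys// -scalerA dot_sys. Qed.

Lemma sop_real_selfadjoint t e : bounded_coeff (real_coeff t) -> orthonormal_sys e ->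
  selfadjoint (sop (real_coeff t) e e).
Proof.
move=> bt oe x y; rewrite sop_adj//.
by rewrite (_ : (fun n => _) = real_coeff t)//; apply/funext => n; exact: conjc_real.
Qed.

Lemma sop_sqr t e (K : R) : (forall n, 0 <= t n) -> (forall n, t n <= K) ->
  orthonormal_basis e ->
  sop (real_coeff (fun n => Num.sqrt (t n))) e e \o
    sop (real_coeff (fun n => Num.sqrt (t n))) e e = sop (real_coeff t) e e.
Proof.
move=> t0 tK be; have oe := onb_sys be.
have bt := real_coeff_bounded t0 tK.
have bs : bounded_coeff (real_coeff (fun n => Num.sqrt (t n))).
  apply: (@real_coeff_bounded _ (Num.sqrt K)) => n; first exact: sqrtr_ge0.
  exact: ler_wsqrtr.
have bS := sop_bounded bs oe oe.
apply: (onb_ext _ _ be); first exact: bounded_op_comp.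
  exact: sop_bounded.
move=> n /=; rewrite !sop_diag// (linopZ bS.1) sop_diag// scalerA.
by rewrite /real_coeff -realcM -expr2 sqr_sqrtr.
Qed.

(** The operator is the square of the self-adjoint one with coefficients sqrt t_n, so its quadratic
    form is a square norm. *)
Lemma sop_positive t e (K : R) : (forall n, 0 <= t n) -> (forall n, t n <= K) ->
  orthonormal_basis e -> positive_op (sop (real_coeff t) e e).
Proof.
move=> t0 tK be; have oe := onb_sys be.
split; first by apply: sop_bounded => //; exact: real_coeff_bounded tK.
have bs : bounded_coeff (real_coeff (fun n => Num.sqrt (t n))).
  apply: (@real_coeff_bounded _ (Num.sqrt K)) => n; first exact: sqrtr_ge0.
  exact: ler_wsqrtr.
move=> x; rewrite -(sop_sqr t0 tK be) /= (sop_real_selfadjoint bs oe).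
by rewrite dotxx ler0c sqr_ge0.
Qed.

End Diagonal.

Section AbsPow.
Context {R : realType} {H : hilbertType R}.
Implicit Types (x y : H) (e f : nat -> H) (T S P Q : H -> H) (t s : nat -> R).
Context (sepH : separable H).

Lemma adjointP T : bounded_op T ->
  bounded_op (adjoint T) /\ forall x y, '[T x, y] = '[x, adjoint T y].
Proof.
move=> bT; have [e be] := onb_exists sepH.
have [S bS TS] := adjoint_exists bT be.
(* [xget] returns some map with the adjoint relation; as that relation determines the map, it
   coincides with the bounded [S]. *)
have aT : forall x y, '[T x, y] = '[x, adjoint T y].
  apply: (@xgetPex _ (0 : H -> H) [set S | forall x y, '[T x, y] = '[x, S y]]).
  by exists S.
suff -> : adjoint T = S by [].
by apply/funext => y; apply: dot_extr => z; rewrite -aT.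
Qed.

Lemma adjoint_bounded T : bounded_op T -> bounded_op (adjoint T).
Proof. by case/adjointP. Qed.

Lemma adjointE T x y : bounded_op T -> '[T x, y] = '[x, adjoint T y].
Proof. by case/adjointP. Qed.

Lemma adjointEl T x y : bounded_op T -> '[adjoint T x, y] = '[x, T y].
Proof. by move=> bT; rewrite dotC -adjointE// -dotC. Qed.

Lemma adjoint_uniq T S : bounded_op T -> (forall x y, '[T x, y] = '[x, S y]) ->
  adjoint T = S.
Proof.
move=> bT TS; apply/funext => y; apply: dot_extr => z.
by rewrite -adjointE// TS.
Qed.

Lemma adjointK T : bounded_op T -> adjoint (adjoint T) = T.
Proof.
move=> bT; apply: adjoint_uniq; first exact: adjoint_bounded.
by move=> x y; rewrite adjointEl.
Qed.

Lemma adjointZ a T : bounded_op T -> adjoint (a *: T) = conjc a *: adjoint T.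
Proof.
move=> bT; apply: adjoint_uniq; first exact: bounded_opZ.
by move=> x y; rewrite !fctE dotZl dotZr conjcK adjointE.
Qed.

Lemma compactoid_adjoint T : bounded_op T -> compactoid T ->
  compactoid (adjoint T).
Proof.
move=> bT cT; have baT := adjoint_bounded bT.
apply: (@compactoid_sqr _ _ _ T baT.1).
  by move=> x y; rewrite adjointEl.
exact: compactoid_compr.
Qed.

Lemma abs_opP T : bounded_op T -> compactoid T ->
  positive_op (abs_op T) /\ abs_op T \o abs_op T = adjoint T \o T.
Proof.
move=> bT cT; have baT := adjoint_bounded bT.
pose P := adjoint T \o T.
have bP : bounded_op P by exact: bounded_op_comp.
have pP : positive_op P.
  by split=> // x; rewrite /P/= adjointEl// dotxx ler0c sqr_ge0.
have cP : compactoid P by exact: compactoid_compl.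
have [e [t eb]] := spectral sepH pP cP.
have [K K0 tK] := eigenbasis_bounded bP eb.
have [be t0 et Pe] := eb.
apply: (@xgetPex _ (0 : H -> H)
  [set S | positive_op S /\ S \o S = adjoint T \o T]).
exists (sop (real_coeff (fun n => Num.sqrt (t n))) e e); split.
  by apply: (@sop_positive _ _ _ _ (Num.sqrt K)) => // n; exact: ler_wsqrtr.
have oe := onb_sys be; have bt := real_coeff_bounded t0 tK.
rewrite (sop_sqr t0 tK be); apply: (onb_ext (sop_bounded bt oe oe) bP be) => n.
by rewrite sop_diag// Pe.
Qed.

(** As [e] is total, the last condition determines a bounded [T]. The family [f] need not be total,
    and it may vanish where [s] does. *)
Definition svd T s e f := [/\ orthonormal_basis e, orthonormal_sys f,
  forall n, 0 <= s n,
  forall n, s n <> 0 -> nrm (e n) = 1 /\ nrm (f n) = 1 &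
  forall n, T (e n) = (s n)%:C *: f n].

(** For eigenvectors of |T|, <T e_m, T e_n> = s_m s_n <e_m, e_n>, so the nonzero images become
    orthonormal once divided by s_n. *)
Lemma abs_svd T : bounded_op T -> compactoid T -> exists e s f,
  eigenbasis (abs_op T) e s /\ svd T s e f.
Proof.
move=> bT cT; have [pS SS] := abs_opP bT cT; set S := abs_op T in pS SS *.
have saS := positive_selfadjoint pS.
have cS : compactoid S.
  apply: (@compactoid_sqr _ _ _ S pS.1.1) => [x y|]; first by rewrite saS.
  by rewrite SS; apply: compactoid_compl => //; exact: adjoint_bounded.
have [e [s eb]] := spectral sepH pS cS; have [be s0 es Se] := eb.
pose f n : H := if s n == 0 then 0 else (s n)^-1%:C *: T (e n).
have TT m n : '[T (e m), T (e n)] = (s m * s n)%:C * '[e m, e n].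
  rewrite adjointE// -[adjoint T _]/((adjoint T \o T) (e n)) -SS /=.
  by rewrite -saS !Se dotZl dotZr conjc_real mulrA realcM.
exists e, s, f; split=> //; split=> //.
- split=> [m n mn|n]; rewrite /f.
    case: eqP => _; first by rewrite dot0l.
    case: eqP => _; first by rewrite dot0r.
    by rewrite dotZl dotZr TT; case: be => -> //; rewrite !mulr0.
  case: eqP => [|/eqP sn]; [by left|right].
  have [e0|e1] := nrm_sys n (onb_sys be).
    by move: sn; rewrite (es _ (nrm_eq0 e0)) eqxx.
  have : nrm ((s n)^-1%:C *: T (e n)) ^+ 2 = 1.
    rewrite nrm_dotE dotZl dotZr TT dotxx e1 expr1n mulr1 conjc_real -!realcM /=.
    by field.
  move=> /eqP; rewrite sqrf_eq1 => /orP[/eqP h|/eqP h]; first by rewrite nrmE h.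
  by have := nrm_ge0 ((s n)^-1%:C *: T (e n)); rewrite h oppr_ge0 ler10.
- move=> n /eqP sn.
  have [e0|e1] := nrm_sys n (onb_sys be).
    by move: sn; rewrite (es _ (nrm_eq0 e0)) eqxx.
  split=> //; rewrite /f (negbTE sn) nrmZ nrm_real normrV ?unitfE// ger0_norm//.
  have : nrm (T (e n)) ^+ 2 = s n ^+ 2.
    by rewrite nrm_dotE TT dotxx e1 expr1n mulr1 /= expr2.
  move=> /eqP; rewrite eqf_sqr => /orP[/eqP ->|/eqP h]; first by rewrite mulVf.
  have := nrm_ge0 (T (e n)); rewrite h oppr_ge0 => sn0.
  by move: sn; rewrite eq_le sn0 s0.
- move=> n; rewrite /f; case: eqP => [sn|/eqP sn].
    rewrite scaler0; apply: dot_eq0; rewrite TT sn mulr0.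
    by rewrite (_ : 0%:C = 0)// mul0r.
  by rewrite scalerA -realcM mulfV// scale1r.
Qed.

(** An eigenvector for [a] is orthogonal to each [e n] with t_n <> a, so the diagonal operator acts
    on it as a^r. Operators that do so agree on the basis. *)
Lemma pow_opE P e t (r : R) : bounded_op P -> selfadjoint P -> eigenbasis P e t ->
  0 < r -> pow_op P r = sop (real_coeff (fun n => t n `^ r)) e e.
Proof.
move=> bP saP eb r0; have [be t0 et Pe] := eb.
have oe := onb_sys be.
have [K K0 tK] := eigenbasis_bounded bP eb.
have bc : bounded_coeff (real_coeff (fun n => t n `^ r)).
  apply: (@real_coeff_bounded _ _ (K `^ r)) => n; first exact: powR_ge0.
  by rewrite ge0_ler_powR ?nnegrE// ltW.
set Q := sop _ _ _; have bQ : bounded_op Q by exact: sop_bounded.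
have [bp hp] : bounded_op (pow_op P r) /\ forall (a : R) (v : H),
    P v = a%:C *: v -> pow_op P r v = (a `^ r)%:C *: v.
  apply: (@xgetPex _ (0 : H -> H) [set Q | bounded_op Q /\
    forall (a : R) (v : H), P v = a%:C *: v -> Q v = (a `^ r)%:C *: v]).
  exists Q; split=> // a v Pv; apply: (onb_ext_dot be) => n.
  rewrite sop_dot// -mulrA dot_sysM// dotZl.
  have [->|ven] := eqVneq '[v, e n] 0; first by rewrite !mulr0.
  have : a%:C * '[v, e n] = (t n)%:C * '[v, e n].
    by rewrite -dotZl -Pv saP Pe dotZr conjc_real.
  by move/(mulIf ven) => [->].
by apply: (onb_ext bp bQ be) => n; rewrite /Q sop_diag//; exact: hp.
Qed.

Lemma eigenbasis_pow_bounded P e t (r : R) : bounded_op P -> eigenbasis P e t ->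
  0 < r -> bounded_coeff (real_coeff (fun n => t n `^ r)).
Proof.
move=> bP eb r0; have [be t0 et Pe] := eb.
have [K K0 tK] := eigenbasis_bounded bP eb.
apply: (@real_coeff_bounded _ _ (K `^ r)) => n; first exact: powR_ge0.
by rewrite ge0_ler_powR ?nnegrE// ltW.
Qed.

Lemma is_trace_unique T (c d : R[i]) : is_trace T c -> is_trace T d -> c = d.
Proof.
move=> Tc Td; have [e be] := onb_exists sepH.
exact: limC_unique (Tc e be) (Td e be).
Qed.

Lemma traceE T (c : R[i]) : is_trace T c -> trace T = c.
Proof.
move=> Tc; have Tt : is_trace T (trace T).
  by apply: (@xgetPex _ (0 : R[i]) (is_trace T)); exists c.
exact: is_trace_unique Tt Tc.
Qed.

Lemma trace_pow_cvg P e t (r : R) c : bounded_op P -> selfadjoint P ->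
  eigenbasis P e t -> 0 < r -> is_trace (pow_op P r) c ->
  c = (complex.Re c)%:C /\ series (fun n => t n `^ r) @ \oo --> complex.Re c.
Proof.
move=> bP saP eb r0 Pc; have [be t0 et Pe] := eb.
have bc := eigenbasis_pow_bounded bP eb r0.
have h := Pc e be.
have hE N : series (fun n => '[pow_op P r (e n), e n] : R[i]^o) N =
    (series (fun n => t n `^ r) N)%:C.
  rewrite /series/= realc_sum; apply: eq_bigr => n _.
  rewrite (pow_opE bP saP eb r0) sop_diag//; last exact: onb_sys.
  rewrite dotZl dotxx -realcM; have [e0|->] := nrm_sys n (onb_sys be).
    by rewrite (et _ (nrm_eq0 e0)) powR0 ?gt_eqF// mul0r.
  by rewrite expr1n mulr1.
have hr : series (fun n => t n `^ r) @ \oo --> complex.Re c.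
  by have /cvg_Re/cvg_ext := h; apply => N; rewrite hE.
split=> //; apply: limC_unique h _.
by have /cvg_realc/cvg_ext := hr; apply => N; rewrite hE.
Qed.

(** Independence of the basis is an exchange of sums in the nonnegative double series [a]: Bessel's
    inequality for [b] gives [limn (series q) <= S], Parseval's identity in [b] the converse. *)
Lemma pow_trace P e t (r : R) (S : R) : bounded_op P -> selfadjoint P ->
  eigenbasis P e t -> 0 < r -> series (fun n => t n `^ r) @ \oo --> S ->
  is_trace (pow_op P r) S%:C.
Proof.
move=> bP saP eb r0 tS b bb; have [be t0 et Pe] := eb.
have oe := onb_sys be; have ob := onb_sys bb.
have bc := eigenbasis_pow_bounded bP eb r0.
rewrite (pow_opE bP saP eb r0); set Q := sop _ _ _.
pose a n m := t n `^ r * nrm '[b m, e n] ^+ 2.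
pose q m := complex.Re '[Q (b m), b m].
have a0 n m : 0 <= a n m by rewrite mulr_ge0 ?powR_ge0 ?sqr_ge0.
have aq m : series (a^~ m) @ \oo --> q m.
  have /cvg_Re/cvg_ext := sop_dot_cvg (x := b m) (y := b m) bc oe oe.
  apply => N; rewrite Re_sum; apply: eq_bigr => i _.
  by rewrite -mulrA ReZ ['[e i, _]]dotC -nrm_sqr.
have q0 m : 0 <= q m.
  by have := nneg_series_le 0 (fun n => a0 n m) (aq m); rewrite big_geq.
have Qq m : '[Q (b m), b m] = (q m)%:C.
  apply: positive_Re; have [K K0 tK] := eigenbasis_bounded bP eb.
  apply: (@sop_positive _ _ _ _ (K `^ r)) => // n; first exact: powR_ge0.
  by rewrite ge0_ler_powR ?nnegrE// ltW.
suff : series q @ \oo --> S.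
  by move=> /cvg_realc/cvg_ext; apply => N; rewrite /series/= realc_sum;
     apply: eq_bigr => i _; rewrite Qq.
have sumq N : series (fun n => \sum_(0 <= m < N) a n m) @ \oo --> series q N.
  have : (fun K => \sum_(0 <= m < N) series (a^~ m) K) @ \oo --> series q N.
    elim: N => [|N ih].
      rewrite /series/= big_geq//; apply: cvg_ext (cvg_cst _) _ => K.
      by rewrite big_geq.
    rewrite /series/= big_nat_recr//=; apply: cvg_ext (cvgD ih (aq N)) _ => K.
    by rewrite big_nat_recr.
  by move/cvg_ext; apply => K; rewrite /series/= exchange_big.
have qS N : \sum_(0 <= m < N) q m <= S.
  apply: ler_cvg_to (sumq N) tS _; near=> K.
  apply: ler_sum => n _; rewrite -mulr_sumr ler_piMr ?powR_ge0//.
  rewrite (le_trans (bessell _ ob (iota_uniq _ _)))//.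
  by rewrite expr_le1 ?nrm_ge0// nrm_sys_le1.
have [cq limqS] := nneg_series_cvg q0 qS.
suff -> : S = limn (series q) by [].
apply/eqP; rewrite eq_le limqS andbT.
have hK K : series (fun n => t n `^ r) K <= limn (series q).
  have h : \sum_(0 <= n < K)
      t n `^ r * series (fun m => nrm '[e n, b m] ^+ 2) N @[N --> \oo] -->
      \sum_(0 <= n < K) t n `^ r * nrm (e n) ^+ 2.
    elim: K => [|K ih].
      rewrite big_geq//; apply: cvg_ext (cvg_cst _) _ => N.
      by rewrite big_geq.
    rewrite big_nat_recr//=; apply: cvg_ext (cvgD ih _) _; last first.
      by move=> N; rewrite big_nat_recr.
    by apply: cvgMl_tmp; exact: parseval.
  have -> : series (fun n => t n `^ r) K =
      \sum_(0 <= n < K) t n `^ r * nrm (e n) ^+ 2.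
    apply: eq_bigr => n _; have [e0|->] := nrm_sys n oe.
      by rewrite (et _ (nrm_eq0 e0)) powR0 ?gt_eqF// mul0r.
    by rewrite expr1n mulr1.
  apply: ler_cvg_to h cq _; near=> N.
  rewrite (eq_bigr (fun n => \sum_(0 <= m < N) a n m)); last first.
    move=> n _; rewrite mulr_sumr; apply: eq_bigr => m _.
    by rewrite dotC nrm_conjc.
  rewrite exchange_big; apply: ler_sum => m _.
  exact: nneg_series_le (fun n => a0 n m) (aq m).
by apply: (cvgr_to_le tS); near=> K; exact: hK.
Unshelve. all: by end_near. Qed.

End AbsPow.

(** * Young's inequality *)

Section Young.
Context {R : realType}.
Implicit Types (p s t x y a b : R).

Lemma powR_pred p t : 1 < p -> 0 <= t -> t `^ (p - 1) * t = t `^ p.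
Proof.
move=> p1; rewrite le_eqVlt => /predU1P[<-|t0].
  by rewrite mulr0 powR0// gt_eqF// (lt_trans ltr01).
rewrite -[X in _ * X]powRr1 ?ltW// -powRD; last by rewrite (gt_eqF t0) implybT.
by rewrite subrK.
Qed.

(* With M the right-hand side and y = x^p, this is a weighted mean of
   1 - ln M < 1/M and 1 + ln (y/M) <= y/M. *)
Lemma bernoulli_lt p x : 1 < p -> 0 <= x -> x != 1 ->
  x < 1 - p^-1 + x `^ p / p.
Proof.
move=> p1 x0 x1; have p0 : 0 < p by exact: lt_trans p1.
have pV : p^-1 < 1 by rewrite invf_lt1.
have pV0 : 0 < p^-1 by rewrite invr_gt0.
move: x0; rewrite le_eqVlt => /predU1P[<-|x0].
  by rewrite powR0 ?gt_eqF// mul0r addr0 subr_gt0.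
set y := x `^ p; set M := _ + _.
have y0 : 0 < y by rewrite powR_gt0.
have y1 : y != 1.
  apply: contra x1 => /eqP y1; apply/eqP.
  apply: (@powR_injective _ p); rewrite ?nnegrE ?ltW//.
  by rewrite -/y y1 powR1.
have M0 : 0 < M by rewrite addr_gt0 ?divr_gt0// subr_gt0.
(* [M] is a weighted mean of 1 and [y], so M = 1 would force y = 1. This makes [h1] strict. *)
have M1 : M != 1.
  apply: contra y1 => /eqP h; apply/eqP.
  have yp : y / p = p^-1 by rewrite /M in h; lra.
  by rewrite -[y](divfK (lt0r_neq0 p0)) yp mulVf// gt_eqF.
have h1 : 1 + ln M^-1 < M^-1.
  rewrite -[X in _ < X]lnK ?posrE ?invr_gt0// expR_gt1Dx// ln_eq0 ?invr_gt0//.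
  by rewrite invr_eq1.
have h2 : 1 + ln (y / M) <= y / M.
  by rewrite -[X in _ <= X]lnK ?posrE ?divr_gt0// expR_ge1Dx.
rewrite lnV ?posrE// in h1.
rewrite ln_div ?posrE// in h2.
have lny : ln y = p * ln x by rewrite /y ln_powR.
have h3 : (1 - p^-1) * (1 - ln M) < (1 - p^-1) * M^-1.
  by rewrite ltr_pM2l// subr_gt0.
have h4 : p^-1 * (1 + (ln y - ln M)) <= p^-1 * (y / M) by rewrite ler_pM2l.
have e1 : (1 - p^-1) * M^-1 + p^-1 * (y / M) = 1.
  rewrite -[RHS](mulfV (lt0r_neq0 M0)); move: (M^-1) => N; rewrite /M; ring.
have e2 : p^-1 * ln y = ln x by rewrite lny mulKf// gt_eqF.
rewrite -ltr_ln ?posrE//.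
suff : 1 + ln x - ln M < 1 by lra.
rewrite -[X in _ < X]e1; apply: le_lt_trans (ltr_leD h3 h4).
rewrite le_eqVlt; apply/orP; left; apply/eqP; rewrite -e2. ring.
Qed.

(** This is [bernoulli_lt] at s / t, multiplied by t^p; for t = 0 the left side vanishes because p -
    1 > 0. *)
Lemma young_lt p t s : 1 < p -> 0 <= t -> 0 <= s -> t != s ->
  t `^ (p - 1) * s < t `^ p * (1 - p^-1) + s `^ p / p.
Proof.
move=> p1; have p0 : 0 < p by exact: lt_trans p1.
rewrite le_eqVlt => /predU1P[<-|t0] s0 ts.
  rewrite !powR0 ?gt_eqF ?subr_gt0// !mul0r add0r divr_gt0// powR_gt0//.
  by rewrite lt_neqAle ts.
have /(bernoulli_lt p1) : 0 <= s / t by rewrite divr_ge0// ltW.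
have -> : s / t != 1.
  by apply: contra ts => /eqP h; rewrite -[s](divfK (lt0r_neq0 t0)) h mul1r.
move=> /(_ isT); rewrite -(ltr_pM2l (powR_gt0 p t0)) mulrDr [X in _ + X]mulrA.
have -> : t `^ p * (s / t) `^ p = s `^ p.
  by rewrite -(powRM _ (ltW t0) (divr_ge0 s0 (ltW t0))) mulrC divfK// gt_eqF.
by rewrite -{1}(powR_pred p1 (ltW t0)) -mulrA [t * (s / t)]mulrC divfK// gt_eqF.
Qed.

Lemma young_le p t s : 1 < p -> 0 <= t -> 0 <= s ->
  t `^ (p - 1) * s <= t `^ p * (1 - p^-1) + s `^ p / p.
Proof.
move=> p1 t0 s0; have [<-|ts] := eqVneq t s; last exact/ltW/young_lt.
by rewrite powR_pred// mulrBr mulr1 subrK.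
Qed.

(* Young's inequality with t = (x + y) / (a + b) against x / a and y / b. *)
Lemma powRD_le p x y a b : 1 < p -> 0 <= x -> 0 <= y -> 0 < a -> 0 < b ->
  (x + y) `^ p <= (a + b) `^ p *
    (a / (a + b) * (x `^ p / a `^ p) + b / (a + b) * (y `^ p / b `^ p)).
Proof.
move=> p1 x0 y0 a0 b0; have p0 : 0 < p by exact: lt_trans p1.
have ab0 : 0 < a + b by exact: addr_gt0.
pose m := (x + y) / (a + b).
have m0 : 0 <= m by exact: divr_ge0 (addr_ge0 x0 y0) (ltW ab0).
have divp u c : 0 <= u -> 0 < c -> (u / c) `^ p = u `^ p / c `^ p.
  move=> u0 c0; have ci : 0 <= c^-1 by rewrite invr_ge0 ltW.
  rewrite (powRM _ u0 ci); congr (_ * _).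
  by rewrite -(powR_inv1 (ltW c0)) -powRrM mulrC powRrM powR_inv1// powR_ge0.
have h1 := young_le p1 m0 (divr_ge0 x0 (ltW a0)).
have h2 := young_le p1 m0 (divr_ge0 y0 (ltW b0)).
rewrite (divp _ _ x0 a0) in h1; rewrite (divp _ _ y0 b0) in h2.
have -> : (x + y) `^ p = (a + b) `^ p * m `^ p.
  by rewrite -(powRM _ (ltW ab0) m0) mulrC divfK// gt_eqF.
rewrite ler_pM2l ?powR_gt0//.
have wa : 0 <= a / (a + b) by rewrite divr_ge0 ?ltW.
have wb : 0 <= b / (a + b) by rewrite divr_ge0 ?ltW.
have := lerD (ler_wpM2l wa h1) (ler_wpM2l wb h2).
set X := x `^ p / _; set Y := y `^ p / _.
have -> : a / (a + b) * (m `^ (p - 1) * (x / a)) +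
   b / (a + b) * (m `^ (p - 1) * (y / b)) = m `^ p.
  rewrite -(powR_pred p1 m0) /m; field; rewrite !gt_eqF//.
have -> : a / (a + b) * (m `^ p * (1 - p^-1) + X / p) +
   b / (a + b) * (m `^ p * (1 - p^-1) + Y / p) =
   m `^ p * (1 - p^-1) + (a / (a + b) * X + b / (a + b) * Y) / p.
  by field; rewrite !gt_eqF.
set Z := a / (a + b) * X + _; set mp := m `^ p => h.
have : mp / p <= Z / p by rewrite mulrBr mulr1 in h; lra.
by rewrite ler_pM2r// invr_gt0.
Qed.

End Young.

(** * Hoelder's inequality and its equality case *)

Section SchattenBound.
Context {R : realType} {H : hilbertType R} (p : R) (p1 : 1 < p).
Implicit Types (x y : H) (e f g h : nat -> H) (T A B C : H -> H) (t s : nat -> R).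

Let p0 : 0 < p. Proof. exact: lt_trans p1. Qed.
Let pV : p^-1 < 1. Proof. by rewrite invf_lt1. Qed.
Let pV0 : 0 < p^-1. Proof. by rewrite invr_gt0. Qed.

Lemma cvg_sum_nat (F : nat -> nat -> R) (l : nat -> R) N :
  (forall n, F n @ \oo --> l n) ->
  (fun K => \sum_(0 <= n < N) F n K) @ \oo --> \sum_(0 <= n < N) l n.
Proof.
move=> Fl; elim: N => [|N ih].
  by rewrite big_geq//; apply: cvg_ext (cvg_cst _) _ => K; rewrite big_geq.
rewrite big_nat_recr//=; apply: cvg_ext (cvgD ih (Fl N)) _ => K.
by rewrite big_nat_recr.
Qed.

Lemma nrm_sub_conj (z w : R[i]) :
  nrm (z - conjc w) ^+ 2 = nrm z ^+ 2 + nrm w ^+ 2 - complex.Re (z * w) *+ 2.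
Proof.
rewrite !nrm_sqrE; case: z => a b; case: w => c d /=; rewrite mulr2n; ring.
Qed.

(* What is lost when t^(p-1) s Re (z w), for z = <g_n, e_k> and w = <f_k, h_n>, is
   bounded by (t^p (1 - 1/p) + s^p / p) (|z|^2 + |w|^2) / 2. *)
Definition young_defect t s e f g h n k : R :=
  (t n `^ p * (1 - p^-1) + s k `^ p / p - t n `^ (p - 1) * s k) *
    ((nrm '[g n, e k] ^+ 2 + nrm '[f k, h n] ^+ 2) / 2) +
  t n `^ (p - 1) * s k * (nrm ('[g n, e k] - conjc '[f k, h n]) ^+ 2 / 2).

Lemma young_defect_ge0 t s e f g h n k : (forall n, 0 <= t n) ->
  (forall n, 0 <= s n) -> 0 <= young_defect t s e f g h n k.
Proof.
move=> t0 s0; rewrite addr_ge0//.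
  by rewrite mulr_ge0 ?subr_ge0 ?young_le// divr_ge0// addr_ge0 ?sqr_ge0.
by apply: mulr_ge0; [rewrite mulr_ge0 ?powR_ge0|rewrite divr_ge0 ?sqr_ge0].
Qed.

Lemma young_defectE t s e f g h n k :
  t n `^ (p - 1) * (s k * complex.Re ('[g n, e k] * '[f k, h n])) +
    young_defect t s e f g h n k =
  t n `^ p * (1 - p^-1) * ((nrm '[g n, e k] ^+ 2 + nrm '[f k, h n] ^+ 2) / 2) +
  s k `^ p / p * ((nrm '[g n, e k] ^+ 2 + nrm '[f k, h n] ^+ 2) / 2).
Proof. rewrite /young_defect nrm_sub_conj mulr2n; field; exact: lt0r_neq0. Qed.

Lemma half_le1 (a b : R) : a <= 1 -> b <= 1 -> (a + b) / 2 <= 1.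
Proof. lra. Qed.

(** The weights [m n k] have row and column sums at most 1, so each half of Young's bound collapses
    to a single series. All defects are nonnegative; keeping an arbitrary one on the left prepares
    the equality case. The sequence [t] is free, so it need not consist of singular values. *)
Lemma svd_young T t s e f g h (S : R) N n0 k0 : bounded_op T -> svd T s e f ->
  (forall K, \sum_(0 <= k < K) s k `^ p <= S) ->
  orthonormal_sys g -> orthonormal_sys h -> (forall n, 0 <= t n) -> (n0 < N)%N ->
  \sum_(0 <= n < N) t n `^ (p - 1) * complex.Re '[T (g n), h n] +
    young_defect t s e f g h n0 k0 <=
  (\sum_(0 <= n < N) t n `^ p) * (1 - p^-1) + S / p.
Proof.
move=> bT [be of_ s0 _ Te] sS og oh t0 n0N; have oe := onb_sys be.
pose z n k := '[g n, e k]; pose w n k := '[f k, h n].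
pose m n k := (nrm (z n k) ^+ 2 + nrm (w n k) ^+ 2) / 2.
have unit_sqr e' n : orthonormal_sys e' -> nrm (e' n) ^+ 2 <= 1.
  by move=> oe'; rewrite expr_le1 ?nrm_ge0// nrm_sys_le1.
have mk n K : \sum_(0 <= k < K) m n k <= 1.
  rewrite -mulr_suml big_split/=; apply: half_le1.
    exact: le_trans (bessel _ oe (iota_uniq _ _)) (unit_sqr _ _ og).
  exact: le_trans (bessell _ of_ (iota_uniq _ _)) (unit_sqr _ _ oh).
have mn k : \sum_(0 <= n < N) m n k <= 1.
  rewrite -mulr_suml big_split/=; apply: half_le1.
    exact: le_trans (bessell _ og (iota_uniq _ _)) (unit_sqr _ _ oe).
  exact: le_trans (bessel _ oh (iota_uniq _ _)) (unit_sqr _ _ of_).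
pose F n K := t n `^ (p - 1) * \sum_(0 <= k < K) s k * complex.Re (z n k * w n k).
have Fl n : F n @ \oo --> t n `^ (p - 1) * complex.Re '[T (g n), h n].
  apply: cvgMl_tmp.
  have /cvg_Re/cvg_ext := fourier_dot (x := g n) (y := h n) bT be; apply => K.
  rewrite Re_sum; apply: eq_bigr => k _.
  by rewrite Te dotZl mulrCA ReZ.
have FK := cvg_sum_nat (N := N) Fl.
apply: (cvgr_to_le (cvgD FK (cvg_cst (young_defect t s e f g h n0 k0)))).
near=> K.
have k0K : (k0 < K)%N by near: K; exists k0.+1.
have dle : young_defect t s e f g h n0 k0 <=
    \sum_(0 <= n < N) \sum_(0 <= k < K) young_defect t s e f g h n k.
  rewrite (bigD1_seq n0) ?mem_index_iota ?iota_uniq//= (bigD1_seq k0)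
    ?mem_index_iota ?iota_uniq//= -addrA lerDl addr_ge0// sumr_ge0// => k _.
    exact: young_defect_ge0.
  by apply: sumr_ge0 => j _; exact: young_defect_ge0.
apply: le_trans (lerD (lexx _) dle) _; rewrite -big_split/=.
rewrite (eq_bigr (fun n => \sum_(0 <= k < K)
    (t n `^ p * (1 - p^-1) * m n k + s k `^ p / p * m n k))); last first.
  move=> n _; rewrite /F mulr_sumr -big_split/=; apply: eq_bigr => k _.
  exact: young_defectE.
under eq_bigr do rewrite big_split/=.
rewrite big_split/= lerD//.
  rewrite mulr_suml; apply: ler_sum => n _; rewrite -mulr_sumr ler_piMr//.
  by rewrite mulr_ge0 ?powR_ge0// subr_ge0 ltW.
rewrite exchange_big/=; apply: le_trans (ler_wpM2r (ltW pV0) (sS K)).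
rewrite mulr_suml; apply: ler_sum => k _; rewrite -mulr_sumr ler_piMr//.
by rewrite divr_ge0 ?powR_ge0// ltW.
Unshelve. all: by end_near. Qed.

(* For 1 < p this says ||T||_p^p <= S. It is stable under sums, scalings and
   adjoints without any knowledge of the singular values of T. *)
Definition sbnd T (S : R) := forall g h, orthonormal_sys g -> orthonormal_sys h ->
  forall N, \sum_(0 <= n < N) nrm '[T (g n), h n] `^ p <= S.

(** The value at 0 is 1, so that the modulus is 1 everywhere and multiplying by phases preserves
    orthonormal systems. *)
Definition phase (u : R[i]) : R[i] := if u == 0 then 1 else u / `|u|.

Lemma nrm_phase u : nrm (phase u) = 1.
Proof.
rewrite /phase; case: eqVneq => u0; first by rewrite /nrm normr1.
by rewrite /nrm normrM normfV normr_id mulfV// normr_eq0.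
Qed.

Lemma phaseM u : conjc (phase u) * u = (nrm u)%:C.
Proof.
rewrite /phase; case: eqVneq => [->|u0]; first by rewrite mulr0 nrm0.
have nu0 : (nrm u)%:C != 0 :> R[i].
  by rewrite (fmorph_eq0 (real_complex R)); apply: contra u0 => /eqP/nrm_eq0 ->.
apply: (mulIf nu0); rewrite nrmE conjcM conjc_inv conjc_real.
by rewrite mulrAC divfK// mulrC -nrm_sqr expr2 realcM.
Qed.

Lemma orthonormal_phase h (a : nat -> R[i]) : orthonormal_sys h ->
  (forall n, nrm (a n) = 1) -> orthonormal_sys (fun n => a n *: h n).
Proof.
move=> oh a1; split=> [m n mn|n]; first by rewrite dotZl dotZr oh.1// !mulr0.
have [->|h1] := oh.2 n; [by left; rewrite scaler0|right].
by rewrite nrmE nrmZ a1 mul1r -nrmE.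
Qed.

(** In [svd_young], take t_n = |<T g_n, h_n>| and absorb the phases in [h]: the sum X of the t_n^p
    satisfies X <= X (1 - 1/p) + S/p. *)
Lemma svd_sbnd T s e f (S : R) : bounded_op T -> svd T s e f ->
  (forall K, \sum_(0 <= k < K) s k `^ p <= S) -> sbnd T S.
Proof.
move=> bT sT sS g h og oh [|N].
  by rewrite big_geq//; have := sS 0%N; rewrite big_geq.
pose a n := phase '[T (g n), h n]; pose t n := nrm '[T (g n), h n].
have t0 n : 0 <= t n by exact: nrm_ge0.
have oh' : orthonormal_sys (fun n => a n *: h n).
  by apply: orthonormal_phase => // n; exact: nrm_phase.
have := svd_young 0 bT sT sS og oh' t0 (ltn0Sn N).
have s0 : forall n, 0 <= s n by case: sT.
have := young_defect_ge0 e f g (fun n => a n *: h n) 0 0 t0 s0.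
set d := young_defect _ _ _ _ _ _ _ _ => d0.
rewrite (eq_bigr (fun n => t n `^ p)); last first.
  by move=> n _; rewrite dotZr phaseM /= -/(t n) powR_pred.
set X := \sum_(0 <= n < N.+1) t n `^ p => hX.
have : X / p <= S / p by rewrite mulrBr mulr1 in hX; lra.
by rewrite ler_pM2r.
Qed.

Lemma sbnd_svd T s e f (S : R) : svd T s e f -> sbnd T S ->
  forall K, \sum_(0 <= k < K) s k `^ p <= S.
Proof.
move=> [be of_ s0 sn Te] TS K; apply: le_trans (TS e f (onb_sys be) of_ K).
apply: ler_sum => k _; rewrite Te dotZl nrmM nrm_real ger0_norm// dotxx nrm_real.
have [->|/eqP/sn[_ ->]] := eqVneq (s k) 0; first by rewrite mul0r.
by rewrite expr1n normr1 mulr1.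
Qed.

Lemma sbndZ a T S : sbnd T S -> sbnd (a *: T) (nrm a `^ p * S).
Proof.
move=> TS g h og oh N.
apply: le_trans (ler_wpM2l (powR_ge0 _ _) (TS g h og oh N)).
rewrite mulr_sumr; apply: ler_sum => n _.
by rewrite fctE dotZl nrmM powRM ?nrm_ge0.
Qed.

(** Systems with a single nonzero vector, x/|x| and T x/|T x|, detect the coefficient |T x|/|x|. *)
Lemma sbnd0 T : linear T -> sbnd T 0 -> T = 0.
Proof.
move=> lT T0; apply/funext => x; rewrite -[RHS]/(0 : H).
apply: contrapT => Tx0.
have x0 : nrm x != 0.
  by apply/eqP => /nrm_eq0 x0; apply: Tx0; rewrite x0 (linop0 lT).
have y0 : nrm (T x) != 0 by apply/eqP => /nrm_eq0.
pose u (v : H) n : H := if n is 0 then (nrm v)^-1%:C *: v else 0.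
have ou v : nrm v != 0 -> orthonormal_sys (u v).
  move=> v0; split=> [[|m] [|n] //= _|[|n] /=]; rewrite ?dot0l ?dot0r//; last by left.
  right; rewrite nrmE nrmZ nrm_real ger0_norm ?invr_ge0 ?nrm_ge0//.
  by rewrite mulVf.
have := T0 _ _ (ou _ x0) (ou _ y0) 1%N; rewrite big_nat1/=.
rewrite (linopZ lT) dotZl dotZr dotxx conjc_real -!realcM nrm_real.
apply/negP; rewrite -ltNge powR_gt0// normr_gt0.
by rewrite !mulf_neq0 ?invr_eq0 ?sqrf_eq0.
Qed.

(** Minkowski's inequality: [powRD_le] bounds each term by a convex combination, with weights
    a/(a+b) and b/(a+b), of terms whose sums are at most 1. Zero bounds are set apart because they
    become divisors. *)
Lemma sbndD A B (a b : R) : linear A -> linear B -> 0 <= a -> 0 <= b ->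
  sbnd A (a `^ p) -> sbnd B (b `^ p) -> sbnd (A + B) ((a + b) `^ p).
Proof.
move=> lA lB; rewrite le_eqVlt => /predU1P[<- _|a0].
  by rewrite powR0 ?gt_eqF// => /(sbnd0 lA) ->; rewrite !add0r.
rewrite le_eqVlt => /predU1P[<-|b0].
  by rewrite powR0 ?gt_eqF// => + /(sbnd0 lB) ->; rewrite !addr0.
move=> AS BS g h og oh N.
have ab0 : 0 < a + b by exact: addr_gt0.
apply: (@le_trans _ _ (\sum_(0 <= n < N) (a + b) `^ p *
    (a / (a + b) * (nrm '[A (g n), h n] `^ p / a `^ p) +
     b / (a + b) * (nrm '[B (g n), h n] `^ p / b `^ p)))).
  apply: ler_sum => n _.
  apply: le_trans (powRD_le p1 (nrm_ge0 _) (nrm_ge0 _) a0 b0).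
  rewrite ge0_ler_powR ?nnegrE ?addr_ge0 ?nrm_ge0 ?(ltW p0)//.
  by rewrite fctE dotDl ler_nrmD.
rewrite -mulr_sumr ler_piMr ?powR_ge0// big_split/= -!mulr_sumr -!mulr_suml.
have hA : (\sum_(0 <= n < N) nrm '[A (g n), h n] `^ p) / a `^ p <= 1.
  by rewrite ler_pdivrMr ?powR_gt0// mul1r AS.
have hB : (\sum_(0 <= n < N) nrm '[B (g n), h n] `^ p) / b `^ p <= 1.
  by rewrite ler_pdivrMr ?powR_gt0// mul1r BS.
have wa : 0 <= a / (a + b) by rewrite divr_ge0 ?ltW.
have wb : 0 <= b / (a + b) by rewrite divr_ge0 ?ltW.
apply: le_trans (lerD (ler_piMr wa hA) (ler_piMr wb hB)) _.
by rewrite -mulrDl mulfV// gt_eqF.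
Qed.

Lemma sbnd_adjoint T S : separable H -> bounded_op T -> sbnd T S ->
  sbnd (adjoint T) S.
Proof.
move=> sH bT TS g h og oh N; apply: le_trans (TS h g oh og N).
by apply: ler_sum => n _; rewrite adjointEl// dotC nrm_conjc.
Qed.

(* The equality case of Hoelder's inequality
   Re tr (|C|^(p-1) W^* A) <= ||C||_p^(p-1) ||A||_p, where C = W |C|. *)
Lemma svd_young_eq A C s e f t g h (S : R) :
  bounded_op A -> bounded_op C -> svd A s e f -> svd C t g h ->
  (forall K, \sum_(0 <= k < K) s k `^ p <= S) ->
  (forall N, \sum_(0 <= n < N) t n `^ p <= S) ->
  (fun N => \sum_(0 <= n < N) t n `^ (p - 1) * complex.Re '[A (g n), h n])
    @ \oo --> S ->
  A = C.
Proof.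
move=> bA bC sA sC sS tS AC.
have [be of_ s0 sn Ae] := sA; have [bg oh t0 tn Cg] := sC.
have oe := onb_sys be; have og := onb_sys bg.
(* As N grows, the left side of [svd_young] tends to S plus the defect, while its right side never
   exceeds S. *)
have d0 n k : young_defect t s e f g h n k <= 0.
  suff : S + young_defect t s e f g h n k <= S by rewrite gerDl.
  apply: (cvgr_to_le (cvgD AC (cvg_cst (young_defect t s e f g h n k)))).
  near=> N.
  have nN : (n < N)%N by near: N; exists n.+1.
  apply: le_trans (svd_young k bA sA sS og oh t0 nN) _.
  have : (\sum_(0 <= n < N) t n `^ p) * (1 - p^-1) <= S * (1 - p^-1).
    by rewrite ler_wpM2r// subr_ge0 ltW.
  lra.
pose z n k := '[g n, e k]; pose w n k := '[f k, h n].
(* Both summands of a vanishing defect are zero: unequal singular values leave no overlap, positive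
   ones force conjugate coefficients. *)
have dec n k : (t n <> s k -> z n k = 0 /\ w n k = 0) /\
    (0 < t n -> 0 < s k -> z n k = conjc (w n k)).
  have := d0 n k; rewrite /young_defect -/(z n k) -/(w n k).
  set Y := (X in X * _ + _); set M := (X in _ * X + _).
  set Z := (X in _ + X).
  have Y0 : 0 <= Y by rewrite subr_ge0 young_le.
  have M0 : 0 <= M by rewrite divr_ge0// addr_ge0 ?sqr_ge0.
  have Z0 : 0 <= Z.
    by apply: mulr_ge0; [rewrite mulr_ge0 ?powR_ge0|rewrite divr_ge0 ?sqr_ge0].
  move=> YMZ; have YM0 := mulr_ge0 Y0 M0.
  have YM : Y * M = 0 by lra.
  have {YMZ}Z00 : Z = 0 by lra.
  split=> [/eqP ts|tp sp].
    have Yp : Y != 0 by rewrite gt_eqF// subr_gt0 young_lt.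
    move: YM => /eqP; rewrite mulf_eq0 (negbTE Yp)/= => /eqP M00.
    have hz := sqr_ge0 (nrm (z n k)); have hw := sqr_ge0 (nrm (w n k)).
    have : nrm (z n k) ^+ 2 = 0 /\ nrm (w n k) ^+ 2 = 0.
      by rewrite /M in M00; split; lra.
    by move=> [/eqP + /eqP]; rewrite !sqrf_eq0 => /eqP/nrm_eq0 -> /eqP/nrm_eq0 ->.
  move: Z00 => /eqP; rewrite /Z mulf_eq0 (gt_eqF (mulr_gt0 (powR_gt0 _ tp) sp))/=.
  rewrite mulf_eq0 invr_eq0 pnatr_eq0 orbF sqrf_eq0 => /eqP/nrm_eq0/eqP.
  by rewrite subr_eq0 => /eqP.
apply: (onb_ext bA bC bg) => n; rewrite Cg.
have zs k : z n k * (s k)%:C = z n k * (t n)%:C.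
  have [->//|/eqP ts] := eqVneq (t n) (s k).
  by have [-> _] := (dec n k).1 ts; rewrite !mul0r.
have hA := fourier_op (x := g n) bA be.
have {}hA : series (fun k => (z n k * (t n)%:C) *: f k) @ \oo --> A (g n).
  move/cvg_ext : hA; apply => K; apply: eq_bigr => k _.
  by rewrite Ae scalerA zs.
have [tn0|/eqP/[dup] tn0' /tn[g1 h1]] := eqVneq (t n) 0.
  rewrite tn0 scale0r; apply: (@cvg_unique _ _ _ _ _ _ hA) => //.
  apply: cvg_ext (cvg_cst _) _ => K; rewrite /series/= big1// => k _.
  by rewrite tn0 mulr0 scale0r.
have tp : 0 < t n by rewrite lt_neqAle t0 andbT eq_sym; apply/eqP.
have zw k : z n k = conjc (w n k).
  have [ts|/eqP ts] := eqVneq (t n) (s k).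
    by apply: (dec n k).2 => //; rewrite -ts.
  by have [-> ->] := (dec n k).1 ts; rewrite conjc0.
(* |A g_n| <= t_n and Re <A g_n, h_n> = t_n with |h_n| = 1 make |A g_n - t_n h_n|^2 at most 0. *)
have nA : nrm (A (g n)) <= t n.
  have /cvg_nrm hN := hA; apply: (cvgr_to_le hN); near=> K.
  rewrite -(@ler_pXn2r _ 2) ?nnegrE ?nrm_ge0//.
  apply: le_trans (nrm_sqr_sum_le _ of_ (iota_uniq _ _)) _.
  rewrite -[leRHS]mulr1 -[X in _ * X](expr1n _ 2) -g1.
  apply: le_trans (ler_wpM2l (sqr_ge0 _) (bessel _ oe (iota_uniq 0 (K - 0)))).
  rewrite mulr_sumr; apply: ler_sum => k _.
  by rewrite nrmM nrm_real ger0_norm// exprMn mulrC.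
have dA : complex.Re '[A (g n), h n] = t n.
  have /(cvg_dotl (y := h n))/cvg_Re hD := hA.
  have -> : t n = t n * nrm (g n) ^+ 2 by rewrite g1 expr1n mulr1.
  apply: (@cvg_unique _ _ _ _ _ _ hD) => //.
  apply: (cvg_ext (cvgMl_tmp (parseval (x := g n) be))) => K.
  rewrite /series/= dot_suml Re_sum mulr_sumr; apply: eq_bigr => k _.
  rewrite dotZl [_ * (t n)%:C]mulrC -mulrA ReZ -/(z n k) -/(w n k); congr (_ * _).
  rewrite -[w n k]conjcK -zw -nrm_sqr//.
apply/eqP; rewrite -subr_eq0; apply/eqP/nrm_eq0/eqP.
rewrite -sqrf_eq0 eq_le sqr_ge0 andbT.
rewrite nrm_sqrB dotZr conjc_real ReZ dA nrmZ nrm_real gtr0_norm// h1 mulr1 mulr2n.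
have : nrm (A (g n)) ^+ 2 <= t n ^+ 2 by rewrite lerXn2r ?nnegrE ?nrm_ge0.
rewrite -expr2; lra.
Unshelve. all: by end_near. Qed.

End SchattenBound.

(** * Schatten norms *)

Section SchattenNorm.
Context {R : realType} {H : hilbertType R} (sepH : separable H).
Context (p : R) (p1 : 1 < p).
Implicit Types (x y : H) (e f g h : nat -> H) (T A B C : H -> H) (t s : nat -> R).

Let p0 : 0 < p. Proof. exact: lt_trans p1. Qed.

Lemma powRVK (x : R) : 0 <= x -> (x `^ p^-1) `^ p = x.
Proof. by move=> x0; rewrite -powRrM mulVf ?powRr1// gt_eqF. Qed.

Lemma powR_inj_p (x y : R) : 0 <= x -> 0 <= y -> x `^ p <= y `^ p -> x <= y.
Proof.
move=> x0 y0; rewrite leNgt => /negP xy; rewrite leNgt; apply/negP => yx.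
by apply: xy; rewrite gt0_ltr_powR ?nnegrE.
Qed.

Lemma schatten_norm_ge0 T : 0 <= schatten_norm p T.
Proof. exact: powR_ge0. Qed.

(** Testing the bound on singular vectors makes the s_n^p summable, which yields the trace. Thus any
    bound gives membership in the class, and ||T||_p^p is the least one. *)
Lemma sbnd_trace T (S : R) : bounded_op T -> compactoid T -> sbnd p T S ->
  is_trace (pow_op (abs_op T) p) (schatten_norm p T `^ p)%:C /\
  sbnd p T (schatten_norm p T `^ p) /\ schatten_norm p T `^ p <= S.
Proof.
move=> bT cT TS; have [e [s [f [eb sT]]]] := abs_svd sepH bT cT.
have [pS _] := abs_opP sepH bT cT.
have sS := sbnd_svd sT TS.
have s0 n : 0 <= s n `^ p by exact: powR_ge0.
have [cs lS] := nneg_series_cvg s0 sS.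
set L := limn _ in lS.
have tr := pow_trace pS.1 (positive_selfadjoint pS) eb p0 cs.
have L0 : 0 <= L.
  by have := nneg_series_le 0 s0 cs; rewrite big_geq.
have -> : schatten_norm p T `^ p = L.
  by rewrite /schatten_norm (traceE sepH tr) powRVK.
split=> //; split=> //.
apply: (svd_sbnd p1 bT sT) => K; exact: nneg_series_le.
Qed.

Lemma schatten_sbnd T c : bounded_op T -> compactoid T ->
  is_trace (pow_op (abs_op T) p) c -> sbnd p T (schatten_norm p T `^ p).
Proof.
move=> bT cT Tc; have [e [s [f [eb sT]]]] := abs_svd sepH bT cT.
have [pS _] := abs_opP sepH bT cT.
have [_ cs] := trace_pow_cvg pS.1 (positive_selfadjoint pS) eb p0 Tc.
have s0 n : 0 <= s n `^ p by exact: powR_ge0.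
have TS : sbnd p T (complex.Re c).
  by apply: (svd_sbnd p1 bT sT) => K; exact: nneg_series_le.
by have [_ []] := sbnd_trace bT cT TS.
Qed.

(* [schatten_norm p T] is 0 when |T|^p has no trace. *)
Lemma schatten_norm0P T : bounded_op T -> compactoid T ->
  schatten_norm p T <> 0 -> sbnd p T (schatten_norm p T `^ p).
Proof.
move=> bT cT T0.
have [[c Tc]|nTc] := pselect (exists c, is_trace (pow_op (abs_op T) p) c).
  exact: schatten_sbnd Tc.
exfalso; apply: T0; rewrite /schatten_norm /trace xgetPN; last first.
  by move=> c Tc; apply: nTc; exists c.
by rewrite powR0// invr_neq0// gt_eqF.
Qed.

Lemma schatten_norm_le T a : bounded_op T -> compactoid T -> 0 <= a ->
  sbnd p T (a `^ p) -> schatten_norm p T <= a.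
Proof.
move=> bT cT a0 Ta; apply: powR_inj_p => //; first exact: schatten_norm_ge0.
by have [_ []] := sbnd_trace bT cT Ta.
Qed.

(** The decomposition is arbitrary, not necessarily the one read off |T|: the sum of its s_n^p and
    ||T||_p^p are both the least [S] with [sbnd p T S]. *)
Lemma svd_cvg T s e f (S : R) : bounded_op T -> compactoid T -> sbnd p T S ->
  svd T s e f -> series (fun n => s n `^ p) @ \oo --> schatten_norm p T `^ p.
Proof.
move=> bT cT TS sT; have [_ [TN _]] := sbnd_trace bT cT TS.
have sN := sbnd_svd sT TN.
have s0 n : 0 <= s n `^ p by exact: powR_ge0.
have [cs lN] := nneg_series_cvg s0 sN.
suff -> : schatten_norm p T `^ p = limn (series (fun n => s n `^ p)) by exact: cs.
apply/eqP; rewrite eq_le lN andbT.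
have Tl : sbnd p T (limn (series (fun n => s n `^ p))).
  by apply: (svd_sbnd p1 bT sT) => K; exact: nneg_series_le.
by have [_ []] := sbnd_trace bT cT Tl.
Qed.

Lemma sbnd_normZ a T : sbnd p T (schatten_norm p T `^ p) ->
  sbnd p (a *: T) ((nrm a * schatten_norm p T) `^ p).
Proof.
move=> TS; rewrite powRM ?nrm_ge0 ?schatten_norm_ge0//; exact: sbndZ.
Qed.

Lemma schatten_normZ a T : bounded_op T -> compactoid T ->
  sbnd p T (schatten_norm p T `^ p) ->
  schatten_norm p (a *: T) = nrm a * schatten_norm p T.
Proof.
move=> bT cT TS.
have le b B : bounded_op B -> compactoid B -> sbnd p B (schatten_norm p B `^ p) ->
    schatten_norm p (b *: B) <= nrm b * schatten_norm p B.
  move=> bB cB BS; apply: schatten_norm_le; last exact: sbnd_normZ.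
  - exact: bounded_opZ.
  - exact: compactoidZ.
  - by rewrite mulr_ge0 ?nrm_ge0 ?schatten_norm_ge0.
apply/eqP; rewrite eq_le le//=.
have [->|a0] := eqVneq a 0.
  by rewrite nrm0 mul0r schatten_norm_ge0.
have na0 : 0 < nrm a.
  by rewrite lt_neqAle nrm_ge0 andbT eq_sym; apply: contra a0 => /eqP/nrm_eq0 ->.
have baT : bounded_op (a *: T) by exact: bounded_opZ.
have caT : compactoid (a *: T) by exact: compactoidZ.
have [_ [aTS _]] := sbnd_trace baT caT (sbnd_normZ a TS).
have := le a^-1 _ baT caT aTS; rewrite scalerA mulVf// scale1r.
rewrite -(ler_pM2l na0) mulrA -nrmM mulfV// [nrm 1](_ : _ = 1) ?mul1r//.
by rewrite /nrm normr1.
Qed.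

Lemma sbnd_normD A B : bounded_op A -> bounded_op B ->
  sbnd p A (schatten_norm p A `^ p) -> sbnd p B (schatten_norm p B `^ p) ->
  sbnd p (A + B) ((schatten_norm p A + schatten_norm p B) `^ p).
Proof.
move=> bA bB; apply: sbndD => //; [exact: bA.1|exact: bB.1| |];
  exact: schatten_norm_ge0.
Qed.

Lemma ler_schatten_normD A B : bounded_op A -> compactoid A ->
  bounded_op B -> compactoid B ->
  sbnd p A (schatten_norm p A `^ p) -> sbnd p B (schatten_norm p B `^ p) ->
  schatten_norm p (A + B) <= schatten_norm p A + schatten_norm p B.
Proof.
move=> bA cA bB cB AS BS; apply: schatten_norm_le; last exact: sbnd_normD.
- exact: bounded_opD.
- exact: compactoidD.
- by rewrite addr_ge0 ?schatten_norm_ge0.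
Qed.

Lemma schatten_norm_adjoint A : bounded_op A -> compactoid A ->
  sbnd p A (schatten_norm p A `^ p) ->
  schatten_norm p (adjoint A) = schatten_norm p A /\
  sbnd p (adjoint A) (schatten_norm p (adjoint A) `^ p).
Proof.
move=> bA cA AS.
have baA := adjoint_bounded sepH bA; have caA := compactoid_adjoint sepH bA cA.
have aAS := sbnd_adjoint sepH bA AS.
have [_ [aAN _]] := sbnd_trace baA caA aAS.
have le1 := schatten_norm_le baA caA (schatten_norm_ge0 A) aAS.
have aaAS := sbnd_adjoint sepH baA aAN; rewrite (adjointK sepH bA) in aaAS.
have le2 := schatten_norm_le bA cA (schatten_norm_ge0 (adjoint A)) aaAS.
by split; [apply/le_anti/andP; split; [exact: le1|exact: le2]|exact: aAN].
Qed.

Lemma schatten_norm_eq0 A : bounded_op A -> sbnd p A (schatten_norm p A `^ p) ->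
  schatten_norm p A = 0 -> A = 0.
Proof.
move=> bA AS A0; apply: (sbnd0 (p := p) bA.1).
by move: AS; rewrite A0 powR0 ?gt_eqF.
Qed.

(** With the same bound [S] on both sides, the weights 1 - 1/p and 1/p of [svd_young] add up to 1. N
    = 0 is separate, as a defect needs an index below N. *)
Lemma young_series_le T t g h (S : R) N : bounded_op T -> compactoid T ->
  sbnd p T S -> orthonormal_sys g -> orthonormal_sys h -> (forall n, 0 <= t n) ->
  (forall N, \sum_(0 <= n < N) t n `^ p <= S) ->
  \sum_(0 <= n < N) t n `^ (p - 1) * complex.Re '[T (g n), h n] <= S.
Proof.
move=> bT cT TS og oh t0 tS; case: N => [|N].
  by rewrite big_geq//; have := tS 0%N; rewrite big_geq.
have [e [s [f [_ sT]]]] := abs_svd sepH bT cT.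
have sS := sbnd_svd sT TS.
have s0 : forall n, 0 <= s n by case: sT.
have := svd_young p1 0 bT sT sS og oh t0 (ltn0Sn N).
have := young_defect_ge0 p1 e f g h 0 0 t0 s0.
have : (\sum_(0 <= n < N.+1) t n `^ p) * (1 - p^-1) <= S * (1 - p^-1).
  by rewrite ler_wpM2r// subr_ge0 ltW// invf_lt1.
lra.
Qed.

Lemma svd_dot T s e f n : svd T s e f ->
  s n `^ (p - 1) * complex.Re '[T (e n), f n] = s n `^ p.
Proof.
move=> [be of_ s0 sn Te]; rewrite Te dotZl ReZ dotxx /=.
have [->|/eqP/sn[_ ->]] := eqVneq (s n) 0.
  by rewrite mul0r mulr0 powR0// gt_eqF.
by rewrite expr1n mulr1 powR_pred.
Qed.

End SchattenNorm.

(** * The equivalences *)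

Section Equivalences.
Context {R : realType} {H : hilbertType R} (sepH : separable H).
Context (p : R) (p1 : 1 < p).
Implicit Types (x y : H) (e f g h : nat -> H) (A B U : H -> H) (t s : nat -> R).

Let p0 : 0 < p. Proof. exact: lt_trans p1. Qed.

Lemma nrm1 (a : R[i]) : `|a| = 1 <-> nrm a = 1.
Proof. by split=> [h|h]; [rewrite /nrm h|rewrite nrmE h]. Qed.

Lemma nrm_nat n : nrm (n%:R : R[i]) = n%:R.
Proof.
by rewrite -[RHS]ger0_norm ?ler0n// -nrm_real (rmorph_nat (real_complex R)).
Qed.

Lemma nrm_half : nrm (2^-1 : R[i]) = 2^-1.
Proof.
apply: (@mulIf _ 2); first by rewrite pnatr_eq0.
rewrite -[X in _ * X = _]nrm_nat -nrmM !mulVf ?pnatr_eq0//.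
exact/nrm1/normr1.
Qed.

Lemma unit_conjM (a : R[i]) : nrm a = 1 -> conjc a * a = 1.
Proof. by move=> a1; rewrite mulrC -nrm_sqr a1 expr1n. Qed.

Lemma zero_adjoint_scalar A : A = 0 ->
  exists alpha : R[i], `|alpha| = 1 /\ A = alpha *: adjoint A.
Proof.
move=> ->; exists 1; split; first by rewrite normr1.
rewrite scale1r; apply/esym/(adjoint_uniq sepH bounded_op0) => x y.
by rewrite -['[_, y]]/'[0, y] -['[x, _]]/'[x, 0] dot0l dot0r.
Qed.

Lemma norm_parallel_adjoint A : bounded_op A -> compactoid A ->
  sbnd p A (schatten_norm p A `^ p) -> norm_parallel p A (adjoint A) ->
  exists alpha : R[i], `|alpha| = 1 /\ A = alpha *: adjoint A.
Proof.
move=> bA cA AS [l [/nrm1 l1 lE]].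
have baA := adjoint_bounded sepH bA; have caA := compactoid_adjoint sepH bA cA.
have [aN aAS] := schatten_norm_adjoint sepH p1 bA cA AS.
rewrite aN in lE aAS; set a := schatten_norm p A in AS lE aAS.
have a0 : 0 <= a by exact: schatten_norm_ge0.
have [az|an0] := eqVneq a 0.
  exact/zero_adjoint_scalar/(schatten_norm_eq0 p1 bA AS az).
set B := A + l *: adjoint A in lE.
have blA : bounded_op (l *: adjoint A) by exact: bounded_opZ.
have clA : compactoid (l *: adjoint A) by exact: compactoidZ.
have bB : bounded_op B by exact: bounded_opD.
have cB : compactoid B by exact: compactoidD.
(* The norm of [B] is 2a <> 0, hence not the default value, so [B] does lie in the class. *)
have BS : sbnd p B (schatten_norm p B `^ p).
  apply: (schatten_norm0P sepH p1 bB cB) => /eqP; rewrite lE -mulr2n.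
  by rewrite mulrn_eq0 (negbTE an0).
have [g [t [h [_ sB]]]] := abs_svd sepH bB cB.
have [bg oh t0 _ _] := sB; have og := onb_sys bg.
have tS := svd_cvg sepH p1 bB cB BS sB.
set S := schatten_norm p B `^ p in BS tS.
have tle N : \sum_(0 <= n < N) t n `^ p <= S by exact: sbnd_svd sB BS N.
have two : nrm (2 : R[i]) = 2 := nrm_nat 2.
have S2 T : sbnd p T (a `^ p) -> sbnd p ((2 : R[i]) *: T) S.
  have -> : S = nrm (2 : R[i]) `^ p * a `^ p.
    have aa : a + a = 2 * a by ring.
    by rewrite /S lE two aa (powRM p (ler0n R 2) a0).
  exact: sbndZ.
pose X := (2 : R[i]) *: A; pose Y := (2 : R[i]) *: (l *: adjoint A).
have XS : sbnd p X S by exact: S2.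
have YS : sbnd p Y S.
  by apply: S2; have := sbndZ (p := p) l aAS; rewrite l1 powR1 mul1r.
have bX : bounded_op X by exact: bounded_opZ.
have cX : compactoid X by exact: compactoidZ.
have bY : bounded_op Y by exact: bounded_opZ.
have cY : compactoid Y by exact: compactoidZ.
suff XB : X = B.
  exists l; split; first exact/nrm1.
  apply: (addrI A); rewrite -/B -XB; apply/funext => x.
  by rewrite -[LHS]/(A x + A x) -[RHS]/(2 *: A x) scaler_nat mulr2n.
have [e [s [f [_ sX]]]] := abs_svd sepH bX cX.
apply: (svd_young_eq p1 bX bB sX sB (sbnd_svd sX XS) tle).
pose v (T : H -> H) n := t n `^ (p - 1) * complex.Re '[T (g n), h n].
(* Since X + Y = 2 B, the sums for [X] and [Y] add up to twice the sum of the t_n^p, which tends to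
   2 S. The sum for [Y] is at most S, so that for [X] is squeezed to S. *)
apply: (@squeeze_cvgr _ _ _ _
    (fun N => series (fun n => t n `^ p) N + series (fun n => t n `^ p) N - S)
    (fun=> S)).
- near=> N; rewrite (young_series_le sepH p1 _ bX cX XS og oh t0 tle) andbT.
  rewrite lerBlDr; apply: le_trans (lerD (lexx _)
    (young_series_le sepH p1 N bY cY YS og oh t0 tle)).
  rewrite /series/= -!big_split/=; apply: ler_sum => n _.
  have hB := svd_dot p1 n sB.
  have dbl (z : H) : '[(2 : R[i]) *: z, h n] = '[z, h n] + '[z, h n].
    by rewrite scaler_nat mulr2n dotDl.
  have XYB : complex.Re '[X (g n), h n] + complex.Re '[Y (g n), h n] =
      complex.Re '[B (g n), h n] + complex.Re '[B (g n), h n].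
    have -> : '[X (g n), h n] = '[(2 : R[i]) *: A (g n), h n] by [].
    have -> : '[Y (g n), h n] = '[(2 : R[i]) *: (l *: adjoint A (g n)), h n] by [].
    have -> : '[B (g n), h n] = '[A (g n) + l *: adjoint A (g n), h n] by [].
    by rewrite !dbl dotDl !ReD; ring.
  by rewrite -hB -(mulrDr (t n `^ (p - 1))) -(mulrDr (t n `^ (p - 1))) XYB.
- by rewrite -[X in _ --> X](addrK S); apply: cvgB; [exact: cvgD|exact: cvg_cst].
- exact: cvg_cst.
Unshelve. all: by end_near. Qed.

Lemma polar_svd A U e s f n : bounded_op U -> polar_decomposition A U ->
  eigenbasis (abs_op A) e s -> svd A s e f -> s n <> 0 -> U (e n) = f n.
Proof.
move=> bU [_ AU _] [_ _ _ Pe] [_ _ _ _ Ae] /eqP sn.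
have : (s n)%:C *: U (e n) = (s n)%:C *: f n.
  by rewrite -Ae [in RHS]AU /= Pe (linopZ bU.1).
by apply: scalerI; rewrite (fmorph_eq0 (real_complex R)).
Qed.

Lemma trace_adjoint_scalar A U : bounded_op A -> compactoid A ->
  sbnd p A (schatten_norm p A `^ p) -> polar_decomposition A U ->
  `| trace (pow_op (abs_op A) (p - 1) \o adjoint U \o adjoint A) |
     = (schatten_norm p A `^ p)%:C ->
  exists alpha : R[i], `|alpha| = 1 /\ A = alpha *: adjoint A.
Proof.
move=> bA cA AS AU; have bU : bounded_op U by case: AU => [[]].
have baA := adjoint_bounded sepH bA; have caA := compactoid_adjoint sepH bA cA.
have [aN aAS] := schatten_norm_adjoint sepH p1 bA cA AS.
rewrite aN in aAS; set S := schatten_norm p A `^ p in AS aAS *.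
set T := _ \o adjoint A; set c := trace T => cS.
have ncS : nrm c = S by apply: complexI; rewrite -nrmE.
have [S0|Sn0] := eqVneq S 0.
  by apply: zero_adjoint_scalar; apply: (sbnd0 (p := p) bA.1); rewrite -S0.
(* Without a trace, [c] would be the default 0, against |c| = S <> 0. *)
have trT : is_trace T c.
  have [[d Td]|nT] := pselect (exists d, is_trace T d).
    by have -> : c = d := traceE sepH Td.
  have c0 : c = 0 by apply: xgetPN => d Td; apply: nT; exists d.
  by exfalso; move/eqP: Sn0; apply; rewrite -ncS c0 nrm0.
have [g [t [h [eb sA]]]] := abs_svd sepH bA cA.
have [pP _] := abs_opP sepH bA cA; have saP := positive_selfadjoint pP.
have [bg oh t0 tn Ag] := sA; have og := onb_sys bg.
have p10 : 0 < p - 1 by rewrite subr_gt0.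
(* In the eigenbasis of |A|, U g_n = h_n where t_n <> 0; elsewhere both sides vanish because p - 1 >
   0. *)
have Tg n : '[T (g n), g n] = (t n `^ (p - 1))%:C * '[adjoint A (g n), h n].
  have bp1 := eigenbasis_pow_bounded pP.1 eb p10.
  rewrite /T (pow_opE pP.1 saP eb p10).
  have -> : '[(sop (real_coeff (fun k => t k `^ (p - 1))) g g \o adjoint U \o
      adjoint A) (g n), g n] =
    '[sop (real_coeff (fun k => t k `^ (p - 1))) g g
      (adjoint U (adjoint A (g n))), g n] by [].
  rewrite (sop_dot _ n bp1 og og) -mulrA (dot_sysM n _ og) (adjointEl sepH _ _ bU).
  have [tn0|/eqP tn0] := eqVneq (t n) 0.
    by rewrite /real_coeff tn0 (powR0 (lt0r_neq0 p10)) !mul0r.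
  by rewrite (polar_svd bU AU eb sA tn0).
(* [gam] rotates the trace onto its modulus S, so that the real parts of the rotated series attain
   the bound. *)
pose gam := conjc (phase c); have gam1 : nrm gam = 1 by rewrite nrm_conjc nrm_phase.
pose X := gam *: adjoint A.
have bX : bounded_op X by exact: bounded_opZ.
have cX : compactoid X by exact: compactoidZ.
have XS : sbnd p X S by have := sbndZ (p := p) gam aAS; rewrite gam1 powR1 mul1r.
have [e [s [f [_ sX]]]] := abs_svd sepH bX cX.
suff XA : X = A.
  by exists gam; split; [exact/nrm1|rewrite -/X].
apply: (svd_young_eq p1 bX bA sX sA (sbnd_svd sX XS) (sbnd_svd sA AS)).
have cv : ((fun N => gam * series (fun n => '[T (g n), g n] : R[i]^o) N)
    : nat -> R[i]^o) @ \oo --> (gam * c : R[i]^o).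
  exact: (cvgZl_tmp (trT g bg)).
have gc : complex.Re (gam * c) = S by rewrite phaseM.
have /cvg_Re := cv; rewrite gc => /cvg_ext; apply => N.
rewrite mulr_sumr Re_sum; apply: eq_bigr => n _.
by rewrite Tg mulrCA ReZ -dotZl.
Qed.

(** As A^* is the conjugate of alpha times A, and U^* A = |A|, the operator under the trace is a
    unimodular multiple of |A|^p. *)
Lemma scalar_adjoint_trace A U (alpha : R[i]) : bounded_op A -> compactoid A ->
  sbnd p A (schatten_norm p A `^ p) -> polar_decomposition A U ->
  nrm alpha = 1 -> A = alpha *: adjoint A ->
  `| trace (pow_op (abs_op A) (p - 1) \o adjoint U \o adjoint A) |
     = (schatten_norm p A `^ p)%:C.
Proof.
move=> bA cA AS AU a1 AE; have bU : bounded_op U by case: AU => [[]].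
have [trS _] := sbnd_trace sepH p1 bA cA AS.
have baA := adjoint_bounded sepH bA; have baU := adjoint_bounded sepH bU.
have [g [t [h [eb sA]]]] := abs_svd sepH bA cA.
have [pP _] := abs_opP sepH bA cA; have saP := positive_selfadjoint pP.
have [bg oh t0 tn Ag] := sA; have og := onb_sys bg.
have p10 : 0 < p - 1 by rewrite subr_gt0.
have aAE x : adjoint A x = conjc alpha *: A x.
  by rewrite [in RHS]AE fctE scalerA unit_conjM// scale1r.
have bp1 := eigenbasis_pow_bounded pP.1 eb p10.
have bp := eigenbasis_pow_bounded pP.1 eb p0.
have TE : pow_op (abs_op A) (p - 1) \o adjoint U \o adjoint A =
    conjc alpha *: pow_op (abs_op A) p.
  rewrite (pow_opE pP.1 saP eb p10) (pow_opE pP.1 saP eb p0).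
  have bp1S := sop_bounded bp1 og og; have bpS := sop_bounded bp og og.
  apply: (onb_ext _ _ bg).
  - by apply: bounded_op_comp => //; exact: bounded_op_comp.
  - exact: bounded_opZ.
  move=> n; set P1 := sop _ g g; set P := sop _ g g.
  have -> : (P1 \o adjoint U \o adjoint A) (g n) =
    P1 (adjoint U (adjoint A (g n))) by [].
  have -> : (conjc alpha *: P) (g n) = conjc alpha *: P (g n) by [].
  rewrite /P1 /P aAE Ag scalerA (linopZ baU.1) (linopZ bp1S.1) (sop_diag n bp og).
  have [tn0|tn0] := eqVneq (t n) 0.
    rewrite tn0 mulr0 scale0r /real_coeff tn0 powR0 ?gt_eqF//.
    by rewrite (_ : 0%:C = 0)// scale0r scaler0.
  (* Compare coefficients along g_m: U g_m = h_m where t_m <> 0, and U g_m = 0 where t_m = 0, since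
     [U] and [A] have the same kernel. *)
  have -> : adjoint U (h n) = g n.
    apply: (onb_ext_dot bg) => m; rewrite adjointEl//.
    have [tm0|/eqP tm0] := eqVneq (t m) 0.
      have -> : U (g m) = 0 by case: AU => _ _ ->; rewrite Ag tm0 scale0r.
      rewrite dot0r; have [nm|nm] := eqVneq n m; last by rewrite og.1.
      by rewrite nm tm0 eqxx in tn0.
    rewrite (polar_svd bU AU eb sA tm0).
    have [<-|nm] := eqVneq n m; last by rewrite oh.1// og.1.
    by move/eqP/tn : tn0 => [g1 h1]; rewrite !dotxx g1 h1.
  rewrite sop_diag// !scalerA -mulrA; congr (_ *: _); congr (_ * _).
  by rewrite /real_coeff -realcM mulrC powR_pred.
have trT : is_trace (conjc alpha *: pow_op (abs_op A) p)
    (conjc alpha * (schatten_norm p A `^ p)%:C).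
  move=> b bb; set P := pow_op _ p in trS *.
  have cv : ((fun N => conjc alpha * series (fun n => '[P (b n), b n] : R[i]^o) N)
      : nat -> R[i]^o) @ \oo --> (conjc alpha * (schatten_norm p A `^ p)%:C : R[i]^o).
    exact: (cvgZl_tmp (trS b bb)).
  apply: (cvg_ext cv) => N; rewrite mulr_sumr; apply: eq_bigr => n _.
  by rewrite -dotZl.
rewrite TE (traceE sepH trT) nrmE nrmM nrm_conjc a1 mul1r nrm_real.
by rewrite ger0_norm ?powR_ge0.
Qed.

(** Defined for every complex [c], not only unimodular ones: it is additive in [c], so a difference
    of two values is the value at c - d and its norm is controlled by |c - d|. *)
Definition rotated_re A (c : R[i]) : H -> H :=
  2^-1 *: (c *: A + conjc c *: adjoint A).

Lemma re_opE A c : bounded_op A -> re_op (c *: A) = rotated_re A c.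
Proof. by move=> bA; rewrite /re_op /rotated_re (adjointZ sepH). Qed.

Lemma nrm_cis (t : R) : nrm (cis t) = 1.
Proof.
by apply/eqP; rewrite -(@eqrXn2 _ 2) ?nrm_ge0// nrm_sqrE /= cos2Dsin2 expr1n.
Qed.

(** The angle stays in a compact interval for the sake of the extreme value theorem. [acos] has a
    nonnegative sine, hence the sign change for negative imaginary part. *)
Lemma cis_surj (u : R[i]) : nrm u = 1 ->
  exists2 t : R, t \in `[- pi, pi] & cis t = u.
Proof.
move=> u1; have := nrm_sqrE u; rewrite u1 expr1n; case: u u1 => x y u1 /= xy.
have x1 : -1 <= x <= 1.
  rewrite -ler_norml -(@ler_pXn2r _ 2) ?nnegrE// expr1n real_normK ?num_real//.
  by have := sqr_ge0 y; lra.
have xI : x \in `[(-1), 1] by rewrite in_itv.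
have sy : sin (acos x) = `|y|.
  by rewrite sin_acos// -sqrtr_sqr; congr Num.sqrt; lra.
have pi0 := pi_ge0 R.
have [y0|y0] := leP 0 y.
  exists (acos x); last by rewrite /cis acosK// sy ger0_norm.
  rewrite in_itv/= acos_lepi// andbT (le_trans _ (acos_ge0 x1))//.
  by rewrite oppr_le0.
exists (- acos x); last by rewrite /cis cosN acosK// sinN sy ltr0_norm// opprK.
rewrite in_itv/= lerN2 acos_lepi//= (le_trans _ pi0)// oppr_le0.
exact: acos_ge0.
Qed.

(** * The numerical radius *)

Section Radius.
Context (A : H -> H) (bA : bounded_op A) (cA : compactoid A).
Context (AS : sbnd p A (schatten_norm p A `^ p)).
Let a := schatten_norm p A.
Let baA := adjoint_bounded sepH bA.
Let caA := compactoid_adjoint sepH bA cA.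

Lemma rotated_re_bounded c : bounded_op (rotated_re A c).
Proof.
by apply: bounded_opZ; apply: bounded_opD; exact: bounded_opZ.
Qed.

Lemma rotated_re_compactoid c : compactoid (rotated_re A c).
Proof.
by apply: compactoidZ; apply: compactoidD; exact: compactoidZ.
Qed.

Lemma rotated_re_sbnd c : sbnd p (rotated_re A c) ((nrm c * a) `^ p).
Proof.
have [aN aAS] := schatten_norm_adjoint sepH p1 bA cA AS.
have a0 : 0 <= a by exact: schatten_norm_ge0.
have h : sbnd p (c *: A + conjc c *: adjoint A) ((nrm c * a + nrm c * a) `^ p).
  have ca0 : 0 <= nrm c * a by rewrite mulr_ge0 ?nrm_ge0.
  have h2 := sbnd_normZ (conjc c) aAS; rewrite aN nrm_conjc in h2.
  exact: (sbndD p1 (bounded_opZ c bA).1 (bounded_opZ (conjc c) baA).1 ca0 ca0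
    (sbnd_normZ c AS) h2).
have := sbndZ (p := p) 2^-1 h.
have -> : nrm (2^-1 : R[i]) `^ p * (nrm c * a + nrm c * a) `^ p = (nrm c * a) `^ p.
  have i0 : 0 <= 2^-1 :> R by rewrite invr_ge0 ler0n.
  have x0 : 0 <= nrm c * a + nrm c * a.
    by apply: addr_ge0; exact: (mulr_ge0 (nrm_ge0 c) a0).
  rewrite nrm_half -(powRM p i0 x0); move: (nrm c * a) => z.
  by congr (_ `^ _); field.
exact.
Qed.

Lemma rotated_re_norm_sbnd c :
  sbnd p (rotated_re A c) (schatten_norm p (rotated_re A c) `^ p).
Proof.
by have [_ []] := sbnd_trace sepH p1 (rotated_re_bounded c)
  (@rotated_re_compactoid c) (rotated_re_sbnd c).
Qed.

Lemma rotated_re_le c : schatten_norm p (rotated_re A c) <= nrm c * a.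
Proof.
apply: (schatten_norm_le sepH p1 (rotated_re_bounded c) (@rotated_re_compactoid c)).
  by rewrite mulr_ge0 ?nrm_ge0 ?schatten_norm_ge0.
exact: rotated_re_sbnd.
Qed.

Lemma rotated_re_lipschitz c d :
  schatten_norm p (rotated_re A c) <=
    schatten_norm p (rotated_re A d) + nrm (c - d) * a.
Proof.
have -> : rotated_re A c = rotated_re A d + rotated_re A (c - d).
  have cd : d + (c - d) = c by rewrite addrC subrK.
  by rewrite /rotated_re -scalerDr addrACA -!scalerDl -conjcD cd.
apply: le_trans (ler_schatten_normD sepH p1 _ _ _ _ _ _) _;
  try exact: rotated_re_bounded; try exact: rotated_re_compactoid;
  try exact: rotated_re_norm_sbnd.
by rewrite lerD2l rotated_re_le.
Qed.

Let F (t : R) := schatten_norm p (rotated_re A (cis t)).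

Lemma rotated_re_continuous : continuous F.
Proof.
have a0 : 0 <= a by exact: schatten_norm_ge0.
move=> t; apply/cvgrPdist_le => e e0; rewrite /F.
have cc : (fun u => (`|cos t - cos u| + `|sin t - sin u|) * a) @ t --> (0 : R).
  have c0 (f : R -> R) : continuous f -> (fun u => `|f t - f u|) @ t --> (0 : R).
    move=> cf; have -> : (0 : R) = `|f t - f t| by rewrite subrr normr0.
    by apply: cvg_norm; apply: cvgB; [exact: cvg_cst|exact: cf].
  have -> : (0 : R) = (0 + 0) * a by rewrite addr0 mul0r.
  apply: cvgMr_tmp; apply: cvgD; apply: c0.
    exact: continuous_cos.
  exact: continuous_sin.
have /cvgrPdist_le/(_ _ e0) := cc; apply: filterS => u.
rewrite sub0r normrN ger0_norm; last by rewrite mulr_ge0// addr_ge0.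
apply: le_trans.
have nle : nrm (cis t - cis u) <= `|cos t - cos u| + `|sin t - sin u|.
  rewrite -(@ler_pXn2r _ 2) ?nnegrE ?nrm_ge0 ?addr_ge0// nrm_sqrE /=.
  rewrite [leRHS]sqrrD !real_normK ?num_real// addrAC lerDl mulrn_wge0// mulr_ge0//.
have h1 := rotated_re_lipschitz (cis t) (cis u).
have h2 := rotated_re_lipschitz (cis u) (cis t).
rewrite [nrm (cis u - _)]nrmC in h2.
have h3 := ler_wpM2r a0 nle; rewrite ler_norml; move: h1 h2 h3.
move: (schatten_norm p (rotated_re A (cis t))) => X.
move: (schatten_norm p (rotated_re A (cis u))) => Y.
move: (nrm _ * a) ((_ + _) * a) => w z.
by move=> *; apply/andP; split; lra.
Qed.

(* In particular the supremum defining the radius is over a bounded set. *)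
Lemma radius_attained : exists t : R,
  schatten_numerical_radius p A = F t /\ forall u, F u <= F t.
Proof.
have pi2 : - pi <= pi :> R by have := pi_ge0 R; lra.
have [t tI tM] := EVT_max pi2 (continuous_subspaceT rotated_re_continuous).
have {}tM u : F u <= F t.
  by have [v vI vu] := cis_surj (nrm_cis u); rewrite /F -vu; exact: tM.
have FE u : schatten_norm p (re_op (cis u *: A)) = F u by rewrite (re_opE _ bA).
exists t; split; last exact: tM.
apply/le_anti/andP; split.
  apply: ge_sup; first by exists (F t); exists t; [exact: I|exact: FE].
  by move=> _ [u _ <-]; rewrite FE; exact: tM.
apply: ub_le_sup; last by exists t; [exact: I|exact: FE].
by exists (F t) => _ [u _ <-]; rewrite FE; exact: tM.
Qed.

(** At a maximizing [c], multiplying Re (c A) by twice the conjugate of [c] gives A plus the squared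
    conjugate of [c] times A^*. This sum has norm 2 ||A||_p, and the squared conjugate is the
    required lambda. *)
Lemma radius_parallel : schatten_numerical_radius p A = schatten_norm p A ->
  norm_parallel p A (adjoint A).
Proof.
have [t [-> _]] := radius_attained; rewrite /F; set c := cis t => cE.
have c1 : nrm c = 1 by exact: nrm_cis.
have [aN _] := schatten_norm_adjoint sepH p1 bA cA AS.
exists (conjc c * conjc c); split.
  by apply/nrm1; rewrite nrmM nrm_conjc c1 mulr1.
have -> : A + (conjc c * conjc c) *: adjoint A = (2 * conjc c) *: rotated_re A c.
  apply/funext => x.
  have -> : ((2 * conjc c) *: rotated_re A c) x =
    (2 * conjc c) *: (2^-1 *: (c *: A x + conjc c *: adjoint A x)) by [].
  have -> : (A + (conjc c * conjc c) *: adjoint A) x =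
    A x + (conjc c * conjc c) *: adjoint A x by [].
  have two0 : (2 : R[i]) != 0 by rewrite pnatr_eq0.
  move: (A x) (adjoint A x) (unit_conjM c1) => u v; move: (conjc c) => d dc.
  by rewrite scalerA [2 * d]mulrC (mulfK two0) scalerDr !scalerA dc scale1r.
rewrite (schatten_normZ sepH p1 _ (rotated_re_bounded c) (@rotated_re_compactoid c));
  last exact: rotated_re_norm_sbnd.
rewrite cE aN nrmM nrm_conjc c1 mulr1 nrm_nat.
by move: (schatten_norm p A) => z; ring.
Qed.

Lemma scalar_radius (alpha : R[i]) : nrm alpha = 1 -> A = alpha *: adjoint A ->
  schatten_numerical_radius p A = schatten_norm p A.
Proof.
move=> a1 AE; have [t [-> tM]] := radius_attained.
apply/eqP; rewrite eq_le; apply/andP; split.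
  by apply: le_trans (rotated_re_le _) _; rewrite nrm_cis mul1r.
(* With b^2 the conjugate of alpha, b A is self-adjoint and hence equals its own real part: the
   radius is reached at [b]. *)
pose b := sqrtc (conjc alpha).
have b2 : b * b = conjc alpha by rewrite -expr2 sqr_sqrtc.
have b1 : nrm b = 1.
  apply/eqP; rewrite -(@eqrXn2 _ 2) ?nrm_ge0// expr1n expr2 -nrmM b2 nrm_conjc.
  by rewrite a1.
have [u _ ub] := cis_surj b1.
apply: le_trans (tM u); rewrite /F ub.
have aAE : adjoint A = conjc alpha *: A.
  by rewrite [in RHS]AE scalerA unit_conjM// scale1r.
have -> : rotated_re A b = b *: A.
  have cb : conjc b * conjc alpha = b by rewrite -b2 mulrA unit_conjM// mul1r.
  have aAx x : adjoint A x = conjc alpha *: A x by rewrite [in LHS]aAE.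
  apply/funext => x.
  have -> : rotated_re A b x = 2^-1 *: (b *: A x + conjc b *: adjoint A x) by [].
  have -> : (b *: A) x = b *: A x by [].
  rewrite aAx; move: (A x) => v.
  by rewrite scalerA cb -scalerDl scalerA; congr (_ *: _); field.
by rewrite (schatten_normZ sepH p1 _ bA cA AS) b1 mul1r.
Qed.

End Radius.

End Equivalences.

Theorem proposition5p10 (R : realType) (H : hilbertType R)
  (sepH : separable H) (p : R) (p_gt1 : 1 < p)
  (A U V : H -> H) (Ap : schatten_class p A)
  (AU : polar_decomposition A U) (AV : polar_decomposition (adjoint A) V) :
  [<-> schatten_numerical_radius p A = schatten_norm p A;
       norm_parallel p A (adjoint A);
       `| trace (pow_op (abs_op A) (p - 1) \o adjoint U \o adjoint A) |
         = (schatten_norm p A `^ p)%:C;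
       `| trace (pow_op (abs_op (adjoint A)) (p - 1) \o adjoint V \o A) |
         = (schatten_norm p (adjoint A) `^ p)%:C;
       exists alpha : R[i], `|alpha| = 1 /\ A = alpha *: adjoint A].
Proof.
have [kA [c Ac]] := Ap.
have bA : bounded_op A := kA.1.
have cA := compact_op_compactoid kA.
have AS := schatten_sbnd sepH p_gt1 bA cA Ac.
have baA := adjoint_bounded sepH bA; have caA := compactoid_adjoint sepH bA cA.
have [_ aAS] := schatten_norm_adjoint sepH p_gt1 bA cA AS.
have adjE (alpha : R[i]) : nrm alpha = 1 -> A = alpha *: adjoint A ->
    adjoint A = conjc alpha *: adjoint (adjoint A).
  move=> a1 AE; rewrite (adjointK sepH bA) [in RHS]AE scalerA.
  by rewrite (unit_conjM a1) scale1r.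
have h15 := norm_parallel_adjoint sepH p_gt1 bA cA AS.
have h35 := trace_adjoint_scalar sepH p_gt1 bA cA AS AU.
tfae.
- exact: radius_parallel.
- move=> /h15[alpha [/nrm1 a1 AE]].
  exact: scalar_adjoint_trace AE.
- move=> /h35[alpha [/nrm1 a1 /(adjE _ a1) AE]].
  rewrite -{2}(adjointK sepH bA).
  by apply: scalar_adjoint_trace AE => //; rewrite nrm_conjc.
(* Writing the last [A] as the adjoint of A^* turns (4) into (3) for A^* with its polar factor
   [V]. *)
- rewrite -{2}(adjointK sepH bA).
  move=> /(trace_adjoint_scalar sepH p_gt1 baA caA aAS AV)[alpha [/nrm1 a1 AE]]; exists (conjc alpha).
  split; first by apply/nrm1; rewrite nrm_conjc.
  rewrite [in RHS]AE scalerA (unit_conjM a1) scale1r.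
  by rewrite (adjointK sepH bA).
- move=> [alpha [/nrm1 a1 AE]]; exact: scalar_radius a1 AE.
Qed.
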